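(* Let $W$ be a right-angled Artin group whose defining graph $\Gamma$ is a tree. Then there exist regular languages of normal forms for $\operatorname{Out}^0W$ and for $\operatorname{Aut}^0W$.
   Context: $\Gamma$ is a finite simplicial graph with non-empty vertex set $V=\{v_1,\dots,v_N\}$, with the indexing fixed. The right-angled Artin group $W$ of $\Gamma$ is the group with generators $V$ and relations $v_jv_k=v_kv_j$ whenever $v_j,v_k$ are adjacent in $\Gamma$. $\operatorname{Aut}^0 W$ is the group of automorphisms of $W$ which map each vertex $v_i$ to a conjugate of itself. $S_i$ is the star of $v_i$ (the full subgraph on the vertices at distance at most $1$ from $v_i$). For $1\le i\le N$ and $K$ a connected component of $\Gamma\setminus S_i$, the partial conjugation $\chi_{iK}$ is the automorphism of $W$ with $\chi_{iK}(v_j)=v_iv_jv_i^{-1}$ if $v_j\in K$ and $\chi_{iK}(v_j)=v_j$ if $v_j\notin K$. For each $i$ with $\Gamma\setminus S_i\ne\emptyset$ let $j_i$ be minimal such that $v_{j_i}\in\Gamma\setminus S_i$; $\mathcal P^0$ is the set of partial conjugations $\chi_{iK}$ with $v_{j_i}\notin K$, and $\operatorname{Out}^0W$ is the subgroup of $\operatorname{Aut}W$ generated by $\mathcal P^0$. A regular language of normal forms for a group $G$ is a regular language over a finite alphabet $A^{\pm1}$, where $A$ is a finite generating set of $G$, such that each element of $G$ is spelled by exactly one word of the language. *)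

(* Defs.v *)
From HB Require Import structures.
From mathcomp Require Import all_boot.
From mathcomp Require Import finmap boolp classical_sets.

Set Implicit Arguments.
Unset Strict Implicit.
Unset Printing Implicit Defensive.

Local Open Scope quotient_scope.
Local Open Scope classical_set_scope.
Local Open Scope group_scope.

(** * Words over [X^{±1}] *)

(* The letter [(x, false)] stands for [x], the letter [(x, true)] for the
   formal inverse of [x]. *)
Definition word (X : Type) := seq (X * bool).

Definition word_inv (X : Type) (w : word X) : word X :=
  rev [seq (l.1, ~~ l.2) | l <- w].

Definition word_eval (X : Type) (G : groupType) (f : X -> G) (w : word X) : G :=
  foldr (fun l g => (if l.2 then (f l.1)^-1 else f l.1) * g) 1 w.

(** * The group with generators [X] and relations [R] *)

Section Presentation.
Variables (X : choiceType) (R : word X -> word X -> Prop).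

(* The least congruence on words containing free cancellation and [R]. *)
Inductive word_eq : word X -> word X -> Prop :=
| word_eq_rel u v : R u v -> word_eq u v
| word_eq_cancel x b : word_eq [:: (x, b); (x, ~~ b)] [::]
| word_eq_cat u v s t : word_eq s t -> word_eq (u ++ s ++ v) (u ++ t ++ v)
| word_eq_refl u : word_eq u u
| word_eq_sym u v : word_eq u v -> word_eq v u
| word_eq_trans v u w : word_eq u v -> word_eq v w -> word_eq u w.

Definition word_eqb (u v : word X) : bool := `[< word_eq u v >].

Let word_eqb_refl : reflexive word_eqb.
Proof. by move=> u; apply/asboolP; apply: word_eq_refl. Qed.

Let word_eqb_sym : symmetric word_eqb.
Proof.
by move=> u v; apply/idP/idP => /asboolP h; apply/asboolP/word_eq_sym.
Qed.

Let word_eqb_trans : transitive word_eqb.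
Proof.
by move=> v u w /asboolP h /asboolP k; apply/asboolP/(word_eq_trans h k).
Qed.

Canonical word_eqb_equiv :=
  EquivRel word_eqb word_eqb_refl word_eqb_sym word_eqb_trans.

Definition presented := {eq_quot word_eqb}.

HB.instance Definition _ := Choice.on presented.

Definition presented_class (w : word X) : presented := \pi_({eq_quot word_eqb}) w.

Definition presented_gen (x : X) : presented := presented_class [:: (x, false)].

Let rep (g : presented) : word X := repr (g : {eq_quot word_eqb}).

Let mul (g h : presented) : presented := presented_class (rep g ++ rep h).
Let inv (g : presented) : presented := presented_class (word_inv (rep g)).

Let classE u v : word_eq u v -> presented_class u = presented_class v.
Proof. by move=> h; apply/eqmodP/asboolP. Qed.

Let classP u v : presented_class u = presented_class v -> word_eq u v.
Proof. by move/eqmodP/asboolP. Qed.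

Let repK g : presented_class (rep g) = g.
Proof. exact: reprK. Qed.

Let cat_eq u u' v v' :
  word_eq u u' -> word_eq v v' -> word_eq (u ++ v) (u' ++ v').
Proof.
move=> hu hv; apply: (@word_eq_trans (u' ++ v)).
  exact: (word_eq_cat [::] v hu).
by have := word_eq_cat u' [::] hv; rewrite !cats0.
Qed.

Let mulE u v :
  mul (presented_class u) (presented_class v) = presented_class (u ++ v).
Proof. by apply/classE/cat_eq; apply/classP/repK. Qed.

Let word_invr w : word_eq (w ++ word_inv w) [::].
Proof.
elim: w => [|[x b] w ihw]; first exact: word_eq_refl.
have -> : ((x, b) :: w) ++ word_inv ((x, b) :: w)
    = [:: (x, b)] ++ (w ++ word_inv w) ++ [:: (x, ~~ b)].
  by rewrite /word_inv /= rev_cons -cats1 !catA.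
apply: word_eq_trans (word_eq_cat _ _ ihw) _; exact: word_eq_cancel.
Qed.

Let word_invK : involutive (@word_inv X).
Proof.
move=> w; rewrite /word_inv map_rev revK -map_comp -[RHS]map_id.
by apply: eq_map => -[x b] /=; rewrite negbK.
Qed.

Let word_invl w : word_eq (word_inv w ++ w) [::].
Proof. by rewrite -{2}[w]word_invK; apply: word_invr. Qed.

Let mulA : associative mul.
Proof.
by move=> f g h; rewrite -[f]repK -[g]repK -[h]repK !mulE catA.
Qed.

Let mul1 : left_id (presented_class [::]) mul.
Proof. by move=> g; rewrite -[g]repK mulE. Qed.

Let mulr1 : right_id (presented_class [::]) mul.
Proof. by move=> g; rewrite -[g]repK mulE cats0. Qed.

Let mulV : left_inverse (presented_class [::]) inv mul.
Proof. by move=> g; rewrite -{2}[g]repK mulE; apply/classE/word_invl. Qed.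

Let mulrV : right_inverse (presented_class [::]) inv mul.
Proof. by move=> g; rewrite -{1}[g]repK mulE; apply/classE/word_invr. Qed.

HB.instance Definition _ := isGroup.Build presented mulA mul1 mulr1 mulV mulrV.

End Presentation.

(** * Automorphism groups *)

Section Automorphism.
Variable G : groupType.

Record automorphism := Automorphism {
  autom_fun :> G -> G;
  automM : {morph autom_fun : x y / x * y};
  autom_bij : bijective autom_fun
}.

HB.instance Definition _ := gen_eqMixin automorphism.
HB.instance Definition _ := gen_choiceMixin automorphism.

Let autom_inj (f g : automorphism) : f =1 g -> f = g.
Proof.
case: f g => [f fM fB] [g gM gB] /= /funext fg; rewrite fg in fM fB *.
by congr Automorphism; apply: Prop_irrelevance.
Qed.

Let id_morph : {morph (@id G) : x y / x * y}.
Proof. by []. Qed.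

Let id_bij : bijective (@id G).
Proof. by exists id. Qed.

Definition autom_id := Automorphism id_morph id_bij.

Let comp_morph (f g : automorphism) : {morph (f \o g) : x y / x * y}.
Proof. by move=> x y; rewrite /= !automM. Qed.

Definition autom_comp (f g : automorphism) :=
  Automorphism (@comp_morph f g) (bij_comp (autom_bij f) (autom_bij g)).

Let inv_sig (f : automorphism) : {g : G -> G | cancel f g /\ cancel g f}.
Proof. by apply: cid; case: (autom_bij f) => g fK gK; exists g. Qed.

Let inv_morph (f : automorphism) : {morph sval (inv_sig f) : x y / x * y}.
Proof.
case: (inv_sig f) => g [fK gK] /= x y.
by apply: (can_inj fK); rewrite automM !gK.
Qed.

Let inv_bij (f : automorphism) : bijective (sval (inv_sig f)).
Proof. by case: (inv_sig f) => g [fK gK] /=; exists f. Qed.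

Definition autom_inv (f : automorphism) :=
  Automorphism (@inv_morph f) (inv_bij f).

Let compA : associative autom_comp.
Proof. by move=> f g h; apply: autom_inj. Qed.

Let comp1 : left_id autom_id autom_comp.
Proof. by move=> f; apply: autom_inj. Qed.

Let compr1 : right_id autom_id autom_comp.
Proof. by move=> f; apply: autom_inj. Qed.

Let compV : left_inverse autom_id autom_inv autom_comp.
Proof.
by move=> f; apply: autom_inj => x /=; case: (inv_sig f) => g [fK gK] /=.
Qed.

Let comprV : right_inverse autom_id autom_inv autom_comp.
Proof.
by move=> f; apply: autom_inj => x /=; case: (inv_sig f) => g [fK gK] /=.
Qed.

HB.instance Definition _ :=
  isGroup.Build automorphism compA comp1 compr1 compV comprV.

End Automorphism.

(** * Regular languages of normal forms *)

Definition regular (A : finType) (L : set (seq A)) : Prop :=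
  exists (Q : finType) (q0 : Q) (delta : Q -> A -> Q) (F : {set Q}),
    forall w : seq A, L w <-> foldl delta q0 w \in F.

Definition is_subgroup (G : groupType) (H : set G) : Prop := group_closed [in H].

Definition generated (G : groupType) (S : set G) : set G :=
  smallest (@is_subgroup G) S.

(* The ambient group [G] only serves to express a subgroup [H]; the property
   depends on [H] alone. *)
Definition has_regular_normal_forms (G : groupType) (H : set G) : Prop :=
  exists A : {fset G}, generated [set` A] = H /\
  exists L : set (word A), regular L /\
    forall h : G, H h -> exists! w : word A, L w /\ word_eval val w = h.

(** * Trees and right-angled Artin groups *)

(* A graph with vertices [v_1, ..., v_N] is given by its adjacency relation on
   the type ['I_N] of indices. *)
Section Graph.
Variables (N : nat) (e : rel 'I_N).

Definition is_connected : Prop := forall x y : 'I_N, connect e x y.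

(* The bound on the length excludes the closed walks [x, y, x] along an edge,
   which [ucycle] accepts. *)
Definition is_acyclic : Prop :=
  forall c : seq 'I_N, (2 < size c)%N -> ~ ucycle e c.

Definition is_tree : Prop := is_connected /\ is_acyclic.

Definition star (i : 'I_N) : {set 'I_N} := [set j | (j == i) || e i j]%SET.

Definition outside_star (i : 'I_N) : rel 'I_N :=
  [rel x y | [&& x \notin star i, y \notin star i & e x y]].

Definition is_component (i : 'I_N) (K : {set 'I_N}) : Prop :=
  exists2 x : 'I_N, x \notin star i &
    K = [set y | connect (outside_star i) x y]%SET.

Definition raag_rel (u v : word 'I_N) : Prop :=
  exists j k : 'I_N, [/\ e j k,
    u = [:: (j, false); (k, false)] & v = [:: (k, false); (j, false)]].

Definition raag : groupType := presented raag_rel.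

Definition raag_gen (i : 'I_N) : raag := presented_gen raag_rel i.

(* [raag_gen] generates [raag], so at most one automorphism satisfies this. *)
Definition is_partial_conj (i : 'I_N) (K : {set 'I_N})
    (chi : automorphism raag) : Prop :=
  forall j : 'I_N, chi (raag_gen j) =
    if j \in K then raag_gen i * raag_gen j * (raag_gen i)^-1 else raag_gen j.

Definition is_min_outside_star (i j : 'I_N) : Prop :=
  j \notin star i /\ forall k : 'I_N, k \notin star i -> (j <= k)%N.

Definition P0 : set (automorphism raag) :=
  [set chi | exists i j K, [/\ is_min_outside_star i j, is_component i K,
                               j \notin K & is_partial_conj i K chi]].

Definition Out0 : set (automorphism raag) := generated P0.

Definition Aut0 : set (automorphism raag) :=
  [set phi | forall i : 'I_N, exists g : raag,
     phi (raag_gen i) = g * raag_gen i * g^-1].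

End Graph.

Arguments P0 {N} e _.
Arguments Out0 {N} e _.
Arguments Aut0 {N} e _.

(* Main.v *)
(* Write phi(v_i) = g_i v_i g_i^-1 for phi in Aut^0 W. Everything rests on the
   positions of the cosets g_i C(v_i) with respect to the parallel walls of
   phi(v_a): for i outside the star of v_a, the coset of i lies in one region
   between consecutive walls, whose number (the level of i at a) is the
   exponent of v_a at the front of g_a^-1 g_i.

   If the levels at a are not all equal, multiplying phi on the right by v_a^-1
   (or v_a) acting on the extremal level set, which is a union of components of
   Gamma \ S_a, brings the cosets closer together. Always choosing the first
   such a spells phi, from right to left. The word obtained is recognised by a
   finite automaton: the letters move a whole level set across walls that
   separate it from the rest, so the order of the levels at every generator
   after the move is determined by the order before the move, and that order
   determines the last letter.

   The process stops when the levels at every a are equal. By ping-pong phi is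
   then inner. For Aut^0 the identity of W is kept as an additional point, which
   forces phi = 1; for Out^0 each level set is moved towards v_{j_a}, so that
   only elements of Out^0 occur, and Out^0 contains no nontrivial inner
   automorphism. *)

Require Import Defs.
From mathcomp Require Import all_boot all_order ssralg ssrnum ssrint zify.
From mathcomp Require Import finmap boolp classical_sets.

Set Implicit Arguments.
Unset Strict Implicit.
Unset Printing Implicit Defensive.

Local Open Scope group_scope.

(** * Words, presentations and the universal property *)

Section Words.
Variables (X : Type) (G : groupType) (f : X -> G).

Lemma word_eval_cat u v : word_eval f (u ++ v) = word_eval f u * word_eval f v.
Proof. by elim: u => [|l u IH] /=; rewrite ?mul1g // IH mulgA. Qed.

Lemma word_eval_rcons w l :
  word_eval f (rcons w l) = word_eval f w * (if l.2 then (f l.1)^-1 else f l.1).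
Proof. by rewrite -cats1 word_eval_cat /= mulg1. Qed.

Lemma word_eval_inv w : word_eval f (word_inv w) = (word_eval f w)^-1.
Proof.
elim: w => [|[x b] w IH]; first by rewrite /= invg1.
rewrite /word_inv /= rev_cons word_eval_rcons -/(word_inv w) IH /= invgM.
by case: b => //=; rewrite invgK.
Qed.

End Words.

Lemma size_word_inv X (w : word X) : size (word_inv w) = size w.
Proof. by rewrite size_rev size_map. Qed.

Section Presented.
Variables (X : choiceType) (R : word X -> word X -> Prop).
Local Notation cl := (presented_class R).

Lemma presented_classP u v : cl u = cl v <-> word_eq R u v.
Proof.
split=> [/eqmodP/asboolP|] //.
by move=> h; apply/eqmodP/asboolP.
Qed.

Lemma presented_classK (g : presented R) : cl (repr g) = g.
Proof. exact: reprK. Qed.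

Lemma word_eq_cat2 u u' v v' :
  word_eq R u u' -> word_eq R v v' -> word_eq R (u ++ v) (u' ++ v').
Proof.
move=> hu hv; apply: (@word_eq_trans _ _ (u' ++ v)).
  exact: (word_eq_cat [::] v hu).
by have := word_eq_cat u' [::] hv; rewrite !cats0.
Qed.

Lemma word_eq_cons l u v : word_eq R u v -> word_eq R (l :: u) (l :: v).
Proof. exact: (word_eq_cat2 (word_eq_refl _ [:: l])). Qed.

Lemma presented_classM u v : cl (u ++ v) = cl u * cl v.
Proof.
apply/esym/presented_classP.
by apply: word_eq_cat2; apply/presented_classP; exact: presented_classK.
Qed.

Lemma presented_class_gen x b :
  cl [:: (x, b)] = if b then (presented_gen R x)^-1 else presented_gen R x.
Proof.
case: b => //; apply/esym/mulg1_eq; rewrite -presented_classM.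
exact/presented_classP/word_eq_cancel.
Qed.

Lemma presented_classE w : cl w = word_eval (presented_gen R) w.
Proof.
elim: w => [|[x b] w IH] //=.
by rewrite -cat1s presented_classM IH presented_class_gen.
Qed.

Lemma presented_ind (P : presented R -> Prop) :
  P 1 -> (forall x b h, P h -> P (cl [:: (x, b)] * h)) -> forall h, P h.
Proof.
move=> P1 PS h; rewrite -[h]presented_classK.
elim: (repr h) => [|[x b] w IH] //.
by rewrite -cat1s presented_classM; apply: PS.
Qed.

Lemma presented_ind_r (P : presented R -> Prop) :
  P 1 -> (forall x b h, P h -> P (h * cl [:: (x, b)])) -> forall h, P h.
Proof.
move=> P1 PS h; rewrite -[h]presented_classK.
elim/last_ind: (repr h) => [|w [x b] IH] //.
by rewrite -cats1 presented_classM; apply: PS.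
Qed.

Variables (G : groupType) (f : X -> G).
Hypothesis fR : forall u v, R u v -> word_eval f u = word_eval f v.

Lemma word_eval_eq u v : word_eq R u v -> word_eval f u = word_eval f v.
Proof.
elim=> {u v} //.
- by move=> x [] /=; rewrite mulg1 ?mulVg ?mulgV.
- by move=> u v s t _ IH; rewrite !word_eval_cat IH.
- by move=> v u w _ -> _ ->.
Qed.

Definition presented_lift (h : presented R) : G := word_eval f (repr h).

Lemma presented_lift_class w : presented_lift (cl w) = word_eval f w.
Proof. by apply: word_eval_eq; apply/presented_classP/presented_classK. Qed.

Lemma presented_liftM : {morph presented_lift : x y / x * y}.
Proof.
move=> x y; rewrite -[x]presented_classK -[y]presented_classK.
by rewrite -presented_classM !presented_lift_class word_eval_cat.
Qed.

Lemma presented_lift_gen x : presented_lift (presented_gen R x) = f x.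
Proof. by rewrite presented_lift_class /= mulg1. Qed.

End Presented.

Section Morphisms.
Variables (G H : groupType) (f : G -> H).
Hypothesis fM : {morph f : x y / x * y}.

Lemma morph1 : f 1 = 1.
Proof. by apply: (@mulgI _ (f 1)); rewrite -fM !mulg1. Qed.

Lemma morphV x : f x^-1 = (f x)^-1.
Proof. by apply/esym/mulg1_eq; rewrite -fM mulgV morph1. Qed.

End Morphisms.

Lemma presented_morph_eq (X : choiceType) (R : word X -> word X -> Prop)
    (G : groupType) (f g : presented R -> G) :
  {morph f : x y / x * y} -> {morph g : x y / x * y} ->
  (forall x, f (presented_gen R x) = g (presented_gen R x)) -> f =1 g.
Proof.
move=> fM gM fg; elim/presented_ind => [|x b h IH]; first by rewrite !morph1.
by rewrite fM gM IH presented_class_gen; case: b; rewrite ?morphV ?fg.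
Qed.

Lemma generated_subgroup (G : groupType) (S : set G) : is_subgroup (generated S).
Proof.
split=> [|x y]; rewrite !inE.
  by move=> H [[H1 _] _]; rewrite inE in H1.
move=> Hx Hy H HS; have [[_ HV] _] := HS.
by have := HV x y; rewrite !inE; apply; [exact: Hx|exact: Hy].
Qed.

(** * A finite-state criterion for regular normal forms *)

Section Criterion.
Variables (G : groupType) (H : set G) (X : finType) (good : pred X) (f : X -> G).
(** [st] is a finite summary of an element, from which [last] reads the final letter of the normal
    form; [can] tells when a letter may be appended, [next] is the summary after that, and [mu]
    makes the removal of final letters terminate. *)
Variables (Q : finType) (st : G -> Q) (last : Q -> option (X * bool)).
Variables (next : Q -> X * bool -> Q) (can : Q -> X * bool -> bool) (mu : G -> nat).
Let lv (l : X * bool) : G := if l.2 then (f l.1)^-1 else f l.1.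
Hypothesis H_subgroup : is_subgroup H.
Hypothesis H_letters : forall x, good x -> H (f x).
Hypothesis f_inj : {in good &, injective f}.
Hypothesis last_None : forall h, H h -> (last (st h) = None <-> h = 1).
Hypothesis last_Some : forall h l, H h -> last (st h) = Some l ->
  [/\ good l.1, can (st (h * (lv l)^-1)) l & mu (h * (lv l)^-1) < mu h].
Hypothesis st_next : forall h l, H h -> good l.1 -> can (st h) l ->
  st (h * lv l) = next (st h) l.

Let H1 : H 1. Proof. by have [h _] := H_subgroup; rewrite inE in h. Qed.

Let HV x y : H x -> H y -> H (x * y^-1).
Proof. by move=> hx hy; have [_ h] := H_subgroup; have := h x y; rewrite !inE; apply. Qed.

Let HM x y : H x -> H y -> H (x * y).
Proof.
move=> hx hy; rewrite -[y]invgK; apply: (HV hx).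
by rewrite -[y^-1]mul1g; exact: HV.
Qed.

Let H_lv l : good l.1 -> H (lv l).
Proof.
by move=> /H_letters hl; rewrite /lv; case: l.2 => //; rewrite -[_^-1]mul1g; exact: HV.
Qed.

Let A : {fset G} := [fset f x | x in [pred x : X | good x]]%fset.

Let lab_exists (y : A) : exists x, good x && (f x == val y).
Proof. by case: y => y /= /imfsetP[x gx ->]; exists x; rewrite eqxx andbT. Qed.

Let lab (y : A) : X := xchoose (lab_exists y).

Let lab_good y : good (lab y).
Proof. by have /andP[] := xchooseP (lab_exists y). Qed.

Let f_lab y : f (lab y) = val y.
Proof. by have /andP[_ /eqP] := xchooseP (lab_exists y). Qed.

Let lab_onto x : good x -> exists y, lab y = x.
Proof.
move=> gx; have xA : f x \in A by apply/imfsetP; exists x.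
by exists [` xA]%fset; apply: f_inj; [exact: lab_good|exact: gx|rewrite f_lab].
Qed.

Let labl (l : A * bool) : X * bool := (lab l.1, l.2).

Let lvE (l : A * bool) : (if l.2 then (val l.1)^-1 else val l.1) = lv (labl l).
Proof. by rewrite /lv /= f_lab. Qed.

(** A letter is accepted only if it is the one that [last] would remove again from the product.
    [None] is the sink. *)
Let step (q : option Q) (l : A * bool) : option Q :=
  if q isn't Some q then None
  else if can q (labl l) && (last (next q (labl l)) == Some (labl l))
  then Some (next q (labl l)) else None.

Let run (w : word A) := foldl step (Some (st 1)) w.

Let L : set (word A) := [set w | run w != None].

Let run_rcons w l : run (rcons w l) = step (run w) l.
Proof. by rewrite /run foldl_rcons. Qed.

Let eval w := word_eval (G := G) val (w : word A).

Let eval_rcons w l : eval (rcons w l) = eval w * lv (labl l).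
Proof. by rewrite /eval word_eval_rcons lvE. Qed.

Let H_eval w : H (eval w).
Proof.
elim/last_ind: w => [|w l IH]; first exact: H1.
by rewrite eval_rcons; apply: HM => //; apply: H_lv; exact: lab_good.
Qed.

Let L_run w : L w -> run w = Some (st (eval w)).
Proof.
rewrite /L /=; elim/last_ind: w => [|w l IH] //; rewrite run_rcons.
case E: (run w) IH => [q|] //= /(_ isT) [->]; case: ifP => // /andP[c _] _.
by rewrite eval_rcons (@st_next _ (labl l) (H_eval w) (lab_good _) c).
Qed.

Let L_rcons w l : L (rcons w l) <->
  L w /\ can (st (eval w)) (labl l) && (last (st (eval (rcons w l))) == Some (labl l)).
Proof.
have E : L w -> can (st (eval w)) (labl l) ->
    st (eval (rcons w l)) = next (st (eval w)) (labl l).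
  by move=> _ c; rewrite eval_rcons (@st_next _ (labl l) (H_eval w) (lab_good _) c).
split=> [h|[h /andP[c la]]].
  have Lw : L w by move: h; rewrite /L /= run_rcons; case: (run w).
  move: h; rewrite {1}/L /= run_rcons (L_run Lw) /=.
  by case: ifP => // /andP[c la] _; rewrite E // c.
by rewrite /L /= run_rcons (L_run h) /= c -E // la.
Qed.

Let exists_normal_form h : H h -> exists2 w, L w & eval w = h.
Proof.
elim: {h}(mu h).+1 {-2}h (ltnSn (mu h)) => // n IH h mh Hh.
case E: (last (st h)) => [l|]; last first.
  by exists [::] => //; rewrite (last_None Hh).1.
have [gl cl ml] := last_Some Hh E.
have [|w Lw wE] := IH _ (leq_trans ml mh); first exact: HV (H_lv gl).
have [y yE] := lab_onto gl.
have lE : labl (y, l.2) = l by rewrite /labl /= yE -surjective_pairing.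
have ev : eval (rcons w (y, l.2)) = h by rewrite eval_rcons wE lE mulgVK.
exists (rcons w (y, l.2)) => //; apply/L_rcons; split=> //.
by rewrite ev E lE wE cl eqxx.
Qed.

Let lab_inj : injective lab.
Proof. by move=> x y xy; apply: val_inj; rewrite /= -!f_lab xy. Qed.

(** The value of an accepted word determines its final letter through [last], so two words with the
    same value can be peeled from the right. *)
Let normal_form_unique w w' : L w -> L w' -> eval w = eval w' -> w = w'.
Proof.
have no1 u l : L (rcons u l) -> eval (rcons u l) <> 1.
  move=> /L_rcons[_ /andP[_ /eqP la]] /(last_None (H_eval _)).
  by rewrite la.
elim/last_ind: w w' => [|w l IH] w'.
  case/lastP: w' => // w' l' _ /no1 h E; case: h; rewrite -E //.
case/lastP: w' => [/no1 h _ E|w' l' Lw Lw' E]; first by case: h.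
have [Lw1 /andP[_ /eqP la]] := (L_rcons _ _).1 Lw.
have [Lw1' /andP[_ /eqP la']] := (L_rcons _ _).1 Lw'.
move: la'; rewrite -E la => -[El Eb].
have ll : l = l' by rewrite [l]surjective_pairing [l']surjective_pairing (lab_inj El) Eb.
subst l'; rewrite (IH w') //.
by apply: (@mulIg _ (lv (labl l))); rewrite -!eval_rcons.
Qed.

Theorem regular_normal_forms_criterion : has_regular_normal_forms H.
Proof.
exists A; split.
  apply/seteqP; split.
    apply: smallest_sub => // y /= /imfsetP[x gx ->]; exact: H_letters.
  move=> h /exists_normal_form[w _ <-].
  have [g1 gV] := generated_subgroup [set` A]; rewrite inE in g1.
  have gVP x y : generated [set` A] x -> generated [set` A] y ->
      generated [set` A] (x * y^-1).
    by move=> hx hy; have := gV x y; rewrite !inE; apply.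
  have gA (y : A) : generated [set` A] (val y).
    by apply: sub_gen_smallest; exact: valP.
  elim: w => [|[y b] w IH]; first exact: g1.
  have -> : eval ((y, b) :: w) = (if b then (val y)^-1 else val y) * eval w by [].
  rewrite -[eval w]invgK; apply: (gVP); last by rewrite -[_^-1]mul1g; exact: gVP.
  by case: b; rewrite ?gA // -[_^-1]mul1g; exact: gVP.
exists L; split.
  exists (option Q), (Some (st 1)), step, [set q | q != None]%SET => w.
  by rewrite inE.
move=> h /exists_normal_form[w Lw wE]; exists w; split=> // w' [Lw' wE'].
by apply: normal_form_unique => //; rewrite wE.
Qed.

End Criterion.

(** * Pilings and the left exponent of a generator *)

Section Pilings.
Variables (N : nat) (e : rel 'I_N).
Hypotheses (e_sym : symmetric e) (e_irr : irreflexive e).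

Lemma letter_swap (x y : 'I_N * bool) :
  e x.1 y.1 -> word_eq (raag_rel e) [:: x; y] [:: y; x].
Proof.
case: x y => [j a] [k b] /= ejk; apply/presented_classP.
have gC : commute (raag_gen e j) (raag_gen e k).
  rewrite /commute /raag_gen -!(presented_class_gen _ _ false).
  by rewrite -!presented_classM; apply/presented_classP/word_eq_rel; exists j, k.
rewrite -[[:: (j, a); _]]cat1s -[[:: (k, b); _]]cat1s !presented_classM.
rewrite !presented_class_gen.
by case: a b => [] []; rewrite -/(commute _ _);
  do ?[exact: gC|apply: commuteV|apply: commute_sym].
Qed.

(* The stack of [d] lists, from left to right, the letters of a word that do not
   commute past [d]: [Some b] for [d^{±1}] itself, [None] for any other. *)
Definition piling := 'I_N -> seq (option bool).
Implicit Types (p q : piling) (x y : 'I_N * bool) (w : word 'I_N).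

Definition opp_letter x := (x.1, ~~ x.2).
Definition bead x d : option bool := if d == x.1 then Some x.2 else None.
Definition push x p : piling :=
  fun d => if e x.1 d then p d else bead x d :: p d.
Definition pop x p : piling := fun d => if e x.1 d then p d else behead (p d).
(** Left multiplication by a letter, carried over to pilings. *)
Definition act x p : piling :=
  if ohead (p x.1) == Some (Some (~~ x.2)) then pop x p else push x p.
(* Adding a letter at the right end of a word. *)
Definition bot x p : piling :=
  fun d => if e x.1 d then p d else rcons (p d) (bead x d).

Definition empty_piling : piling := fun=> [::].
Definition piles w : piling := foldr push empty_piling w.
Definition pil w : piling := foldr act empty_piling w.

Fixpoint reduced w : bool :=
  if w is x :: w' then
    (ohead (piles w' x.1) != Some (Some (~~ x.2))) && reduced w'
  else true.

(** On an arbitrary family of stacks, which need not come from a word, [act] is not invertible. *)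
Definition valid p := exists2 w, reduced w & p = piles w.

Lemma opp_letterK : involutive opp_letter.
Proof. by case=> x b; rewrite /opp_letter /= negbK. Qed.

Lemma push_head x p : ohead (push x p x.1) = Some (Some x.2).
Proof. by rewrite /push e_irr /bead eqxx. Qed.

Lemma pop_push x y p : y.1 = x.1 -> pop y (push x p) = p.
Proof. by move=> xy; apply/funext => d; rewrite /pop /push xy; case: ifP => ->. Qed.

Lemma push_pushC x y p : e x.1 y.1 -> push x (push y p) = push y (push x p).
Proof.
move=> exy; apply/funext => d; rewrite /push /bead.
case ex: (e x.1 d); case ey: (e y.1 d) => //.
case: (d =P x.1) ey => [->|_ _]; first by rewrite e_sym exy.
by case: (d =P y.1) ex => // ->; rewrite exy.
Qed.

Lemma push_nbr x p d : e x.1 d -> push x p d = p d.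
Proof. by rewrite /push => ->. Qed.

Lemma act_push x p : act (opp_letter x) (push x p) = p.
Proof. by rewrite /act push_head negbK eqxx pop_push. Qed.

Lemma act_pushV x p : act x (push (opp_letter x) p) = p.
Proof. by rewrite -{1}[x]opp_letterK act_push. Qed.

Lemma actE x p : ohead (p x.1) != Some (Some (~~ x.2)) -> act x p = push x p.
Proof. by rewrite /act => /negPf ->. Qed.

(** A letter in front of the one on top of the stack of [c] is adjacent to [c], as otherwise it
    would cover that stack; so the latter can be shuffled to the front. *)
Lemma reduced_front w c b : reduced w -> ohead (piles w c) = Some (Some b) ->
  exists w1, [/\ reduced ((c, b) :: w1), piles w = piles ((c, b) :: w1) &
    word_eq (raag_rel e) w ((c, b) :: w1)].
Proof.
elim: w => [|x w IH] //= /andP[hx rw]; rewrite {1}/push.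
case: ifPn => exc.
  move=> /(IH rw) [w1 [/= /andP[h1 r1] E ww1]].
  have ecx : e c x.1 by rewrite e_sym.
  exists (x :: w1); split=> /=.
  - rewrite push_nbr // h1 r1 andbT /=.
    by move: hx; rewrite E /= push_nbr.
  - by rewrite E /= push_pushC.
  - apply: word_eq_trans (word_eq_cons x ww1) _.
    exact: (word_eq_cat [::] w1 (letter_swap _)).
case: (c =P x.1) => [->|/eqP nc] /= [].
  rewrite /bead eqxx => -[<-]; exists w; case: x hx {exc} => a a' /= hx.
  by rewrite hx rw; split=> //; exact: word_eq_refl.
by rewrite /bead (negPf nc).
Qed.

Lemma valid_front p x : valid p -> ohead (p x.1) = Some (Some x.2) ->
  exists2 q, valid q & p = push x q /\ ohead (q x.1) != Some (Some (~~ x.2)).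
Proof.
case=> w rw -> /(reduced_front rw) [w1 [/= /andP[h r] -> _]].
by exists (piles w1); [exists w1|case: x h].
Qed.

Lemma valid_push x p : valid p -> ohead (p x.1) != Some (Some (~~ x.2)) ->
  valid (push x p).
Proof. by move=> [w rw ->] h; exists (x :: w) => //=; rewrite h. Qed.

Lemma valid_act x p : valid p -> valid (act x p).
Proof.
move=> vp; have [h|h] := boolP (ohead (p x.1) == Some (Some (~~ x.2))).
  have [q vq [-> _]] := @valid_front p (opp_letter x) vp (eqP h).
  by rewrite !act_pushV.
by rewrite actE //; apply: valid_push.
Qed.

Lemma valid_pil w : valid (pil w).
Proof. by elim: w => [|x w IH]; [exists [::]|exact: valid_act]. Qed.

Lemma act_oppK x p : valid p -> act x (act (opp_letter x) p) = p.
Proof.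
move=> vp; case h: (ohead (p x.1) == Some (Some x.2)).
  have [q vq [-> hq]] := valid_front vp (eqP h).
  by rewrite act_push actE.
rewrite [act (opp_letter x) p]actE /= ?negbK ?h //.
by rewrite !act_pushV.
Qed.

Lemma act_pushC x y p : e x.1 y.1 -> valid p ->
  act y (push x p) = push x (act y p).
Proof.
move=> exy vp; have [h|h] := boolP (ohead (p y.1) == Some (Some (~~ y.2))).
  have [q vq [-> _]] := @valid_front p (opp_letter y) vp (eqP h).
  by rewrite push_pushC // !act_pushV.
by rewrite !actE ?push_nbr // push_pushC // e_sym.
Qed.

Lemma act_actC x y p : e x.1 y.1 -> valid p -> act x (act y p) = act y (act x p).
Proof.
(* If one of the letters cancels, [p] is a push of its inverse and [act_pushC] applies; otherwise
   both are pushed. *)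
wlog h : x y / ohead (p x.1) == Some (Some (~~ x.2)) => [H exy vp|exy vp].
  have [/H|hx] := boolP (ohead (p x.1) == Some (Some (~~ x.2))); first exact.
  have [/H->|hy] := boolP (ohead (p y.1) == Some (Some (~~ y.2))) => //.
    by rewrite e_sym.
  have eyx : e y.1 x.1 by rewrite e_sym.
  rewrite (actE hx) (actE hy) [LHS]actE ?push_nbr // [RHS]actE ?push_nbr //.
  exact: push_pushC.
have [q vq [-> _]] := @valid_front p (opp_letter x) vp (eqP h).
by rewrite act_pushC // !act_pushV.
Qed.

(** Opposite letters act on valid pilings by inverse maps, and adjacent letters by commuting maps,
    so the piling is an invariant of the group element. *)
Lemma pil_eq u v : word_eq (raag_rel e) u v -> pil u = pil v.
Proof.
suff H : word_eq (raag_rel e) u v -> forall p, valid p -> foldr act p u = foldr act p v.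
  by move=> /H; apply; exists [::].
elim=> {u v} [u v [j [k [ejk -> ->]]] p vp|x b p vp|u v s t _ IH p vp|||] //.
- by rewrite /= act_actC.
- by have := act_oppK (x, b) vp.
- rewrite !foldr_cat IH //.
  by elim: v => //= x v IHv; exact: valid_act.
- by move=> u v _ IH p vp; rewrite IH.
- by move=> v u w _ IH _ IH' p vp; rewrite IH // IH'.
Qed.

Lemma reduce w :
  exists w', [/\ reduced w', word_eq (raag_rel e) w w' & pil w = piles w'].
Proof.
elim: w => [|x w [w0 [r0 e0 p0]]] /=.
  by exists [::]; split=> //; exact: word_eq_refl.
rewrite p0; have [h|h] := boolP (ohead (piles w0 x.1) == Some (Some (~~ x.2))).
  have [w1 [/= /andP[h1 r1] E ww]] := reduced_front r0 (eqP h).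
  exists w1; split=> //.
    apply: word_eq_trans (word_eq_cons x (word_eq_trans e0 ww)) _.
    case: x {h h1 E ww} => c b.
    exact: (word_eq_cat [::] w1 (word_eq_cancel _ c b)).
  by rewrite E !act_pushV.
exists (x :: w0); split=> /=; rewrite ?h ?actE //.
exact: word_eq_cons.
Qed.

Lemma bot_empty x : act x empty_piling = bot x empty_piling.
Proof. by rewrite actE. Qed.

Lemma push_botC x y p : push x (bot y p) = bot y (push x p).
Proof. by apply/funext => d; rewrite /push /bot; case: ifP; case: ifP. Qed.

(** An empty stack at [c] means that every letter of [w] is adjacent to [c]; hence [d] does not
    occur. *)
Lemma piles_nbr_None w c d : piles w c = [::] -> ~~ e c d ->
  all (pred1 None) (piles w d).
Proof.
elim: w => //= x w IH; rewrite /push; case: ifP => // exc h ncd.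
case: ifP => _; first exact: IH.
rewrite /= IH // andbT /bead; case: (d =P x.1) => // dx.
by move: ncd; rewrite dx e_sym exc.
Qed.

Lemma rcons_None (s : seq (option bool)) :
  all (pred1 None) s -> rcons s None = None :: s.
Proof. by elim: s => //= x s IH /andP[/eqP-> /IH ->]. Qed.

(** The effect of right multiplication by [x]: a bead is added at the bottom or the opposite one is
    taken away, the latter being read backwards as an addition. *)
Definition bot_rel x p p' := p' = bot x p \/ p = bot (opp_letter x) p'.

Lemma bot_rel_sym x p p' : bot_rel x p p' -> bot_rel (opp_letter x) p' p.
Proof. by case=> h; [right; rewrite opp_letterK|left]. Qed.

Lemma act_bot x y p : valid p -> bot_rel x (act y p) (act y (bot x p)).
Proof.
move=> vp; have [h|h] := boolP (ohead (p y.1) == Some (Some (~~ y.2))).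
  have [q vq [-> _]] := @valid_front p (opp_letter y) vp (eqP h).
  by left; rewrite -push_botC !act_pushV.
have [h'|h'] := boolP (ohead (bot x p y.1) == Some (Some (~~ y.2))); last first.
  by left; rewrite !actE // push_botC.
(* The only conflict: the stack of [y] was empty, so the bead added at the bottom is also on top and
   meets its inverse. *)
have [py yx] : p y.1 = [::] /\ y = opp_letter x.
  move: h h'; rewrite /bot; case: ifP => [_ /negP //|_].
  case Ep: (p y.1) => [|z s] /=; [move=> _ | by move/negP]; rewrite /bead.
  case: (y.1 =P x.1) => // yx /eqP[x2]; split=> //.
  by rewrite /opp_letter x2 negbK -yx -surjective_pairing.
have E : bot x p = push x p.
  case: vp => w rw pw; apply/funext => d; rewrite /bot /push.
  case: ifPn => // ncd; rewrite /bead; case: (d =P x.1) => [->|_].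
    by move: py; rewrite yx => ->.
  by rewrite rcons_None // pw (@piles_nbr_None _ x.1) // -pw -py yx.
right; rewrite E {2}yx act_push actE // yx.
case: vp => w rw pw; apply/funext => d; rewrite /bot /push /bead /=.
case: ifPn => // ncd; case: (d =P x.1) => [->|_].
  by move: py; rewrite yx => ->.
by rewrite rcons_None // pw (@piles_nbr_None _ x.1) // -pw -py yx.
Qed.

Lemma pil_rcons w x : bot_rel x (pil w) (pil (rcons w x)).
Proof.
elim: w => [|y w IH] /=; first by left; rewrite /pil /= bot_empty.
case: IH => IH; first by rewrite IH; exact/act_bot/valid_pil.
rewrite IH; rewrite -{1}[x]opp_letterK; apply: bot_rel_sym.
exact/act_bot/valid_pil.
Qed.

Definition sgb (b : bool) : int := if b then (-1)%R else 1%R.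

Fixpoint run (s : seq (option bool)) : int :=
  if s is Some b :: s' then (sgb b + run s')%R else 0%R.

Lemma run_rcons_None (s : seq (option bool)) : run (rcons s None) = run s.
Proof. by elim: s => //= -[b|] s // ->. Qed.

Lemma run_rcons (s : seq (option bool)) o : None \in s -> run (rcons s o) = run s.
Proof. by elim: s => //= -[b|] s IH //; rewrite inE /= => /IH ->. Qed.

Lemma run_act x p : run (act x p x.1) = (sgb x.2 + run (p x.1))%R.
Proof.
rewrite /act; case: eqP => [|_]; last by rewrite /push e_irr /bead eqxx.
rewrite /pop e_irr; case: (p x.1) => //= _ s [->].
by rewrite /sgb; case: x.2 => /=; lia.
Qed.

Lemma act_nbr x p d : e x.1 d -> act x p d = p d.
Proof. by move=> h; rewrite /act; case: ifP; rewrite /pop /push h. Qed.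

End Pilings.

(** * Special subgroups and separation *)

Section Raag.
Variables (N : nat) (e : rel 'I_N).
Hypotheses (e_sym : symmetric e) (e_irr : irreflexive e).
Local Notation W := (raag e).
Local Notation v := (raag_gen e).
Local Notation ev := (presented_class (raag_rel e)).
Implicit Types (a c i j : 'I_N) (S : {set 'I_N}) (g h z : W) (w : word 'I_N).

Definition vpow a (b : bool) : W := if b then (v a)^-1 else v a.

Lemma ev_letter a b : ev [:: (a, b)] = vpow a b.
Proof. exact: presented_class_gen. Qed.

Lemma vpow_negb a b : vpow a (~~ b) = (vpow a b)^-1.
Proof. by case: b => /=; rewrite ?invgK. Qed.

Lemma ev_cons a b w : ev ((a, b) :: w) = vpow a b * ev w.
Proof. by rewrite -cat1s presented_classM ev_letter. Qed.

Lemma ev_rcons w a b : ev (rcons w (a, b)) = ev w * vpow a b.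
Proof. by rewrite -cats1 presented_classM ev_letter. Qed.

Lemma ev_word_inv w : ev (word_inv w) = (ev w)^-1.
Proof. by rewrite !presented_classE word_eval_inv. Qed.

Lemma raag_spell h : exists w, h = ev w.
Proof. by exists (repr h); rewrite presented_classK. Qed.

Lemma raag_ind_l (P : W -> Prop) :
  P 1 -> (forall a b h, P h -> P (vpow a b * h)) -> forall h, P h.
Proof.
by move=> P1 PS; apply: presented_ind => // x b h; rewrite ev_letter; exact: PS.
Qed.

Lemma raag_ind_r (P : W -> Prop) :
  P 1 -> (forall a b h, P h -> P (h * vpow a b)) -> forall h, P h.
Proof.
by move=> P1 PS; apply: presented_ind_r => // x b h; rewrite ev_letter; exact: PS.
Qed.

Lemma star_refl a : a \in star e a. Proof. by rewrite inE eqxx. Qed.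

Lemma star_sym a b : (a \in star e b) = (b \in star e a).
Proof. by rewrite !inE eq_sym e_sym. Qed.

Lemma adj_star a b : e a b -> b \in star e a.
Proof. by rewrite inE => ->; rewrite orbT. Qed.

Lemma gen_commute a b : b \in star e a -> commute (v a) (v b).
Proof.
rewrite inE => /orP[/eqP->|eab]; first exact: commute_refl.
rewrite /commute /raag_gen -!(presented_class_gen _ _ false) -!presented_classM.
exact/presented_classP/letter_swap.
Qed.

Definition killout S i : W := if i \in S then v i else 1.

Lemma killout_rel S u w :
  raag_rel e u w -> word_eval (killout S) u = word_eval (killout S) w.
Proof.
move=> [j [k [ejk -> ->]]] /=; rewrite !mulg1 /killout.
case: ifP; case: ifP; rewrite ?mulg1 ?mul1g // => _ _.
exact/gen_commute/adj_star.
Qed.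

Definition retr S : W -> W := @presented_lift _ (raag_rel e) _ (killout S).

Lemma retrM S : {morph retr S : x y / x * y}.
Proof. exact/presented_liftM/killout_rel. Qed.

Lemma retr1 S : retr S 1 = 1.
Proof. exact/morph1/retrM. Qed.

Lemma retrV S x : retr S x^-1 = (retr S x)^-1.
Proof. exact/morphV/retrM. Qed.

Lemma retr_gen S i : retr S (v i) = if i \in S then v i else 1.
Proof. exact/presented_lift_gen/killout_rel. Qed.

Lemma retr_vpow S i b : retr S (vpow i b) = if i \in S then vpow i b else 1.
Proof.
by case: b; rewrite /= ?retrV retr_gen; case: ifP; rewrite ?invg1.
Qed.

Lemma retrI S S' x : retr S (retr S' x) = retr (S :&: S') x.
Proof.
elim/raag_ind_l: x => [|a b h IH]; first by rewrite !retr1.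
rewrite !retrM IH !retr_vpow inE.
by case: (a \in S'); rewrite ?retr_vpow ?retr1 ?andbT ?andbF.
Qed.

Lemma retrT x : retr [set: 'I_N] x = x.
Proof.
elim/raag_ind_l: x => [|a b h IH]; first by rewrite retr1.
by rewrite retrM IH retr_vpow inE.
Qed.

(** Membership in the subgroup generated by [S], put as an equation so that [retrI] handles
    intersections. *)
Definition special S h := retr S h = h.

Lemma specialM S x y : special S x -> special S y -> special S (x * y).
Proof. by rewrite /special retrM => -> ->. Qed.

Lemma specialV S x : special S x -> special S x^-1.
Proof. by rewrite /special retrV => ->. Qed.

Lemma special_vpow S a b : a \in S -> special S (vpow a b).
Proof. by rewrite /special retr_vpow => ->. Qed.

Lemma special_retr S x : special S (retr S x).
Proof. by rewrite /special retrI finset.setIid. Qed.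

Lemma special1 S : special S 1. Proof. exact: retr1. Qed.

Lemma special_ind S (P : W -> Prop) :
  P 1 -> (forall a b h, a \in S -> P h -> P (vpow a b * h)) ->
  forall h, special S h -> P h.
Proof.
move=> P1 PS h <-; elim/raag_ind_l: h => [|a b h IH]; first by rewrite retr1.
by rewrite retrM retr_vpow; case: ifP => aS; rewrite ?mul1g //; exact: PS.
Qed.

Lemma special_ind_r S (P : W -> Prop) :
  P 1 -> (forall a b h, a \in S -> P h -> P (h * vpow a b)) ->
  forall h, special S h -> P h.
Proof.
move=> P1 PS h <-; elim/raag_ind_r: h => [|a b h IH]; first by rewrite retr1.
by rewrite retrM retr_vpow; case: ifP => aS; rewrite ?mulg1 //; exact: PS.
Qed.

Lemma special_ev S w : (forall x, x \in w -> x.1 \in S) -> special S (ev w).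
Proof.
elim: w => [|[a b] w IH] H; first exact: special1.
rewrite ev_cons; apply: specialM.
  by apply: special_vpow; apply: (H (a, b)); rewrite inE eqxx.
by apply: IH => x xw; apply: H; rewrite inE xw orbT.
Qed.

Lemma special_star_commute a h : special (star e a) h -> commute (v a) h.
Proof.
apply: special_ind => [|c b {}h ca IH]; first exact: commute1.
apply: commuteM => //; have := gen_commute ca.
by case: b => //= ?; apply: commuteV.
Qed.

(* The signed number of letters [a^{±1}] that can be shuffled to the front of
   [h]. *)
Definition lam a h : int := run (pil e (repr h) a).

Lemma lam_ev a w : lam a (ev w) = run (pil e w a).
Proof.
rewrite /lam (_ : pil e (repr (ev w)) = pil e w) //.
exact/(pil_eq e_sym e_irr)/presented_classP/presented_classK.
Qed.

Lemma lam1 a : lam a 1 = 0%R.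
Proof. exact: (lam_ev a [::]). Qed.

Lemma lam_vpowl a b h : lam a (vpow a b * h) = (sgb b + lam a h)%R.
Proof.
have [w ->] := raag_spell h; rewrite -ev_cons !lam_ev /=.
exact: (run_act e_irr (a, b)).
Qed.

Lemma lam_adjl a c b h : e a c -> lam a (vpow c b * h) = lam a h.
Proof.
have [w ->] := raag_spell h => eac; rewrite -ev_cons !lam_ev /=.
by rewrite act_nbr //= e_sym.
Qed.

Lemma lam_vpowr a c b h : c != a -> lam a (h * vpow c b) = lam a h.
Proof.
have [w ->] := raag_spell h => ca; rewrite -ev_rcons !lam_ev.
by case: (pil_rcons e_sym e_irr w (c, b)) => ->; rewrite /bot /=;
  case: ifP => // _; rewrite /bead eq_sym (negPf ca) run_rcons_None.
Qed.

(** A [None] in the stack of [a] stops the count before the bottom, where right multiplication acts.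
    So there is none, and all letters of a reduced word for [h] lie in the star. *)
Lemma lam_change a c b h :
  lam a (h * vpow c b) <> lam a h -> special (star e a) h.
Proof.
have [->|ca] := eqVneq c a; last by rewrite lam_vpowr.
have [w ->] := raag_spell h; rewrite -ev_rcons !lam_ev => H.
have {H} : None \notin pil e w a.
  apply/negP => Nw; apply: H.
  case: (pil_rcons e_sym e_irr w (a, b)) => Ew.
    by rewrite Ew /bot /= e_irr run_rcons.
  move: Nw; rewrite Ew /bot /= e_irr mem_rcons inE /bead /= eqxx /= => Nw.
  by rewrite run_rcons.
have [w' [_ /presented_classP -> ->]] := reduce e_sym e_irr w.
move=> Nw; apply: special_ev => x.
elim: w' Nw => //= y w' IH; rewrite /push /bead => Nw.
rewrite in_cons => /orP[/eqP->|].
  move: Nw; rewrite !inE e_sym [y.1 == a]eq_sym; case: (a == y.1) => //=.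
  by case: (e a y.1).
apply: IH; move: Nw; case: ifP => // _.
by rewrite in_cons negb_or => /andP[].
Qed.

Lemma lam_special_r S a h (c : W) : a \notin S -> special S c -> lam a (h * c) = lam a h.
Proof.
move=> aS; move: c; apply: special_ind_r => [|i b c iS IH]; first by rewrite mulg1.
by rewrite mulgA lam_vpowr // ?IH //; apply: contraNneq aS => <-.
Qed.

Lemma lam_star_l a (c : W) h : special (star e a) c -> lam a (c * h) = (lam a c + lam a h)%R.
Proof.
move: c; apply: special_ind => [|i b c iS IH]; first by rewrite mul1g lam1; lia.
rewrite -mulgA; move: iS; rewrite inE => /orP[/eqP->|ai].
  by rewrite !lam_vpowl IH; lia.
by rewrite !lam_adjl.
Qed.

(** Left multiplication by [v a] raises [lam a]; if it agrees with right multiplication,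
    [lam_change] applies. *)
Lemma centralizer_gen a h : commute (v a) h -> special (star e a) h.
Proof.
move=> ah; apply: (@lam_change a a false); rewrite /= -ah.
by rewrite (lam_vpowl a false h) /=; lia.
Qed.

(* The walls of two generators that do not commute never cross. *)
Lemma lam_sep a b z h : b \notin star e a -> lam a h <> lam a z ->
  lam b (z^-1 * h) = lam b z^-1.
Proof.
move=> ba; have ab : a \notin star e b by rewrite star_sym.
have [w ->] : exists w, h = z * ev w.
  by have [w ww] := raag_spell (z^-1 * h); exists w; rewrite -ww mulVKg.
elim/last_ind: w => [|w [c t] IH]; first by rewrite mulg1.
rewrite ev_rcons mulgA => H.
have [E|/eqP E] := eqVneq (lam a (z * ev w * vpow c t)) (lam a (z * ev w)).
  rewrite E in H; rewrite -(IH H) mulgA.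
  (* If the last letter changed [lam b], then [ev w] would lie in the star subgroup of [b], and
     right multiplication by it does not change [lam a]. *)
  apply/eqP/negPn/negP => /eqP/lam_change sp.
  by apply: H; rewrite -{1}[z * ev w](mulVKg z) (lam_special_r _ ab sp).
(* The last letter crosses a wall of [a], so the endpoint lies in the star subgroup of [a], which
   cannot change [lam b]. *)
rewrite (lam_special_r _ ba) //; apply: specialM; first exact: lam_change E.
apply: special_vpow; have [->|ca] := eqVneq c a; first exact: star_refl.
by case: E; rewrite lam_vpowr.
Qed.

Lemma special_sub S S' h : S \subset S' -> special S h -> special S' h.
Proof. by move=> /finset.setIidPr sS; rewrite /special => <-; rewrite retrI sS. Qed.

Lemma special_star_vpow a b h : special (star e a) h -> commute (vpow a b) h.
Proof.
move/special_star_commute => ah; apply: commute_sym.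
by case: b; [apply: commuteV|]; apply: commute_sym.
Qed.

Lemma lam_reach a k : exists2 y, special [set a]%SET y & lam a y = k.
Proof.
have aa b : special [set a]%SET (vpow a b) by apply: special_vpow; rewrite inE.
case: k => n; elim: n => [|n [y sy ky]].
- by exists 1; [exact: special1|exact: lam1].
- by exists (vpow a false * y); [exact: specialM|rewrite lam_vpowl ky /=; lia].
- exists (vpow a true); first exact: aa.
  by rewrite -[vpow a true]mulg1 lam_vpowl lam1.
- by exists (vpow a true * y); [exact: specialM|rewrite lam_vpowl ky /=; lia].
Qed.

(* Deleting from a path one letter at which it crosses a wall of [g v_a g^-1]
   rotates its endpoint. *)
Lemma cross_shorten a b g y w :
  (0 < sgb b * (lam a (g^-1 * (y * ev w)) - lam a (g^-1 * y)))%R ->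
  exists2 w', size w' < size w &
    y * ev w' = (g * vpow a b * g^-1)^-1 * (y * ev w).
Proof.
elim/last_ind: w => [|w [c t] IH]; first by rewrite mulg1; lia.
rewrite ev_rcons size_rcons (mulgA y) (mulgA g^-1).
set x := g^-1 * (y * ev w) in IH * => H.
have [/IH [w' sw E]|H'] := boolP (0 < sgb b * (lam a x - lam a (g^-1 * y)))%R.
  by exists (rcons w' (c, t)); rewrite ?size_rcons // ev_rcons mulgA E -!mulgA.
have change : lam a (x * vpow c t) <> lam a x.
  by move=> E; move: H; rewrite E (negPf H').
have sp := lam_change change.
have ca : c = a by apply/eqP/negPn/negP => ca; case: change; rewrite lam_vpowr.
(* At the crossing [x] commutes with [v a], so deleting the letter amounts to left multiplication by
   a conjugate of its inverse. *)
subst c; have cm t' := special_star_vpow t' sp.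
have tb : t = b.
  move: H H'; rewrite -cm lam_vpowl.
  by case: (t); case: (b) => //=; lia.
exists w => //; subst t.
rewrite (_ : y * ev w = g * x); last by rewrite mulVKg.
by rewrite !invgM invgK -!(mulgA g) -cm -mulgA mulKg mulKg.
Qed.

(** If the first letter of a word is not counted at its generator, the rest crosses the wall back,
    and [cross_shorten] gives a shorter word. *)
Lemma lam_eq0 h : (forall a, lam a h = 0%R) -> h = 1.
Proof.
have [w ->] := raag_spell h; elim: {w}(size w).+1 {-2}w (ltnSn (size w)) => // n IH.
case=> [|[a b] w] // sw; rewrite ev_cons => H.
have [|w' sw' E] := @cross_shorten a (~~ b) 1 1 w.
  have := H a; rewrite !invg1 !mul1g lam1 lam_vpowl => E.
  by case: (b) E => /=; lia.
have E' : vpow a b * ev w = ev w'.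
  by move: E; rewrite invg1 mulg1 !mul1g => ->; rewrite vpow_negb invgK.
rewrite E' in H *; apply: IH => //.
exact: ltn_trans sw' sw.
Qed.

End Raag.

(** * Conjugating automorphisms and their levels *)

Section Conjugators.
Variables (N : nat) (e : rel 'I_N).
Hypotheses (e_sym : symmetric e) (e_irr : irreflexive e).
Local Notation W := (raag e).
Local Notation v := (raag_gen e).
Local Notation ev := (presented_class (raag_rel e)).
Local Notation vpow := (vpow e).
Local Notation lam := (@lam N e).
Local Notation special := (@special N e).
Implicit Types (a c i j : 'I_N) (S : {set 'I_N}) (h z : W) (w : word 'I_N).

(* The value at [None] is a base point, which is kept at the identity. *)
Definition conjugators (phi : W -> W) (g : option 'I_N -> W) : Prop :=
  g None = 1 /\ forall i, phi (v i) = g (Some i) * v i * (g (Some i))^-1.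

Lemma mulg_conj (x y z : W) : x * y * x^-1 * (x * z * x^-1) = x * (y * z) * x^-1.
Proof. by rewrite !mulgA mulgVK. Qed.

Section Phi.
Variables (phi : W -> W) (g : option 'I_N -> W).
Hypotheses (phiM : {morph phi : x y / x * y}) (phig : conjugators phi g).
Local Notation gs i := (g (Some i)).

Definition level a h : int := lam a ((gs a)^-1 * h).

Lemma phi_vpow i b : phi (vpow i b) = gs i * vpow i b * (gs i)^-1.
Proof.
by case: b => /=; rewrite ?(morphV phiM) phig.2 // !invgM invgK mulgA.
Qed.

Lemma phi_commute x y : commute x y -> commute (phi x) (phi y).
Proof. by rewrite /commute -!phiM => ->. Qed.

Lemma conj_special i j b : j \in star e i ->
  special (star e i) ((gs i)^-1 * (phi (vpow j b) * gs i)).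
Proof.
move=> /(gen_commute (e:=e)) ij; apply: (centralizer_gen e_sym e_irr).
have /phi_commute : commute (v i) (vpow j b) by case: b => //=; exact: commuteV.
rewrite phig.2; set x := phi _ => xc.
have : commute ((gs i)^-1 * ((gs i * v i * (gs i)^-1) * gs i)) ((gs i)^-1 * (x * gs i)).
  rewrite /commute.
  have E : (gs i)^-1 * (gs i * v i / gs i * gs i) * ((gs i)^-1 * (x * gs i)) =
    (gs i)^-1 * ((gs i * v i / gs i) * x) * gs i by rewrite !mulgA !mulgK.
  by rewrite E xc !mulgA !mulgK.
by rewrite -!mulgA mulVg mulg1 mulKg.
Qed.

(** For [z = (gs i)^-1 * gs j], the element [z * v j * z^-1] lies in the star subgroup of [i], so
    the retraction [l] of [z] conjugates [v j] as [z] does. Geometrically, the two cosets of star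
    subgroups meet. *)
Lemma adj_meet i j : e i j ->
  exists2 l, special (star e i) l & special (star e j) ((gs i * l)^-1 * gs j).
Proof.
move=> eij; have [z zE] : exists z, z = (gs i)^-1 * gs j by eexists.
have := conj_special false (adj_star eij).
rewrite phi_vpow [vpow _ _]/= !mulgA -zE => H.
have E : z * v j * (gs j)^-1 * gs i = z * v j * z^-1.
  by rewrite zE invgM invgK !mulgA.
rewrite E /special !retrM retrV retr_gen adj_star // in H.
exists (retr (star e i) z); first exact: special_retr.
apply: (centralizer_gen e_sym e_irr); rewrite invgM -mulgA -zE.
move: H; set l := retr _ _ => H.
apply: (@mulgI _ l); apply: (@mulIg _ z^-1).
by rewrite -!mulgA mulgV mulg1 !mulgA H mulgV mul1g.
Qed.

Lemma level_phi a b h : level a (phi (vpow a b) * h) = (sgb b + level a h)%R.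
Proof.
by rewrite /level phi_vpow -!mulgA mulKg lam_vpowl.
Qed.

(** Seen from [gs a], [phi (v c)] is [l * v c * l^-1] with [l] from [adj_meet]; [lam a] is additive
    on the star subgroup and vanishes on this element. *)
Lemma level_phi_adj a c b h : e a c -> level a (phi (vpow c b) * h) = level a h.
Proof.
move=> eac; have [l sl sx] := adj_meet eac.
have E : (gs a)^-1 * (phi (vpow c b) * h) = (l * vpow c b * l^-1) * ((gs a)^-1 * h).
  have : commute (vpow c b) ((gs a * l)^-1 * gs c) by exact: special_star_vpow.
  rewrite phi_vpow; move: (vpow c b) => y.
  have [x xE] : exists x, x = (gs a * l)^-1 * gs c by eexists.
  rewrite -xE => yx; have -> : gs c = gs a * l * x by rewrite xE mulVKg.
  by rewrite -(mulgA _ x) -yx !invgM !mulgA mulVg mul1g mulgK.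
rewrite /level E lam_star_l //; last first.
  apply: specialM => //; last exact: specialV.
  by apply: specialM => //; apply/special_vpow/adj_star.
have -> : lam a (l * vpow c b * l^-1) = 0%R; last by lia.
rewrite -mulgA lam_star_l // (lam_adjl e_sym e_irr) //.
by rewrite -(lam_star_l e_sym e_irr) // mulgV (lam1 e_sym e_irr).
Qed.

(** [lam_sep] for the moved walls: whatever a wall of [a] separates from the coset of [c] looks
    alike from [c]. *)
Lemma level_sep a c h : c \notin star e a ->
  level a h <> level a (gs c) -> level c h = level c (gs a).
Proof.
move=> ca H; have := lam_sep e_sym e_irr ca H.
by rewrite /level !invgM invgK -!mulgA mulVKg.
Qed.

Lemma level_special i a h z : a \notin star e i -> special (star e i) z ->
  level a (h * z) = level a h.
Proof. by move=> ai sz; rewrite /level mulgA (lam_special_r e_sym e_irr _ ai). Qed.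

(** Adjacent cosets meet. It follows that level sets at [a] are unions of components of the
    complement of its star. *)
Lemma level_adj a i j : i \notin star e a -> j \notin star e a -> e i j ->
  level a (gs i) = level a (gs j).
Proof.
rewrite !(star_sym e_sym _ a) => ia ja /adj_meet[l sl sx].
rewrite -(level_special (gs i) ia sl).
by rewrite -(level_special (gs i * l) ja sx) mulVKg.
Qed.

(** Ping-pong by induction on the length of a word for [x], the common regions playing the role of a
    fundamental domain. *)
Lemma level_equivariant h (k : 'I_N -> int) :
  (forall a, level a h = k a) ->
  (forall a c, c \notin star e a -> level a (gs c) = k a) ->
  forall x a, level a (phi x * h) = (lam a x + k a)%R.
Proof.
move=> hk gk x; have [w ->] := raag_spell x.
elim: {w}(size w).+1 {-2}w (ltnSn (size w)) => // n IH [|[c b] w] sw a.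
  by rewrite (morph1 phiM) mul1g hk (lam1 e_sym e_irr) GRing.add0r.
(* If [lam c] vanishes, the first letter cancels against a later one and a shorter word spells the
   same element. *)
have [z|nz] := eqVneq (lam c (ev ((c, b) :: w))) 0%R.
  have [|w' sw' E] := @cross_shorten _ _ e_sym e_irr c (~~ b) 1 1 w.
    move: z; rewrite ev_cons !invg1 !mul1g (lam1 e_sym e_irr) (lam_vpowl e_sym e_irr).
    by case: (b) => /=; lia.
  have -> : ev ((c, b) :: w) = ev w'.
    by move: E; rewrite invg1 mulg1 !mul1g ev_cons => ->; rewrite vpow_negb invgK.
  by apply: IH; exact: ltn_trans sw' sw.
rewrite ev_cons phiM -mulgA; have [<-|ac] := eqVneq c a.
  by rewrite level_phi (lam_vpowl e_sym e_irr) IH // GRing.addrA.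
have [eac|nac] := boolP (e a c).
  by rewrite level_phi_adj // (lam_adjl e_sym e_irr) // IH.
(* Here [a] and [c] do not commute. A wall of [c] separates the moved point from the starting
   region, so its move is invisible at [a] on both sides of the equation. *)
have ca : a \notin star e c by rewrite inE negb_or eq_sym ac e_sym.
have -> : lam a (vpow c b * ev w) = 0%R.
  rewrite -(lam1 e_sym e_irr a).
  have := @lam_sep _ _ e_sym e_irr c a 1 (vpow c b * ev w) ca.
  rewrite invg1 mul1g; apply; rewrite (lam1 e_sym e_irr) -ev_cons; exact/eqP.
have ac' : c \notin star e a by rewrite (star_sym e_sym).
rewrite GRing.add0r -(gk a c ac').
apply: level_sep => //; rewrite gk // level_phi IH //.
move: nz; rewrite ev_cons (lam_vpowl e_sym e_irr) => /eqP; lia.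
Qed.

Lemma level_inner h (k : 'I_N -> int) : (forall y, exists x, phi x = y) ->
  (forall a, level a h = k a) ->
  (forall a c, c \notin star e a -> level a (gs c) = k a) ->
  forall x, phi x = h * x * h^-1.
Proof.
move=> phi_onto hk gk.
suff H i : phi (v i) = h * v i * h^-1.
  apply: presented_morph_eq => // x y.
  by rewrite mulg_conj.
(* If right multiplication by [v i] changes the level of [h] at [i], then [(gs i)^-1 * h]
   centralizes [v i], as wanted. Otherwise [lam a x = 0] for all [a], so [x = 1] and [v i = 1],
   which is absurd. *)
have [x xE] := phi_onto (h * v i * h^-1).
have [/eqP E|/eqP E] := eqVneq (level i (h * v i)) (level i h); last first.
  have sp : special (star e i) ((gs i)^-1 * h).
    by apply: (@lam_change _ _ e_sym e_irr i i false); rewrite /= -mulgA.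
  have := special_star_commute sp; rewrite phig.2 => zC.
  have [z zE] : exists z, z = (gs i)^-1 * h by eexists.
  have -> : h = gs i * z by rewrite zE mulVKg.
  by rewrite -zE in zC; rewrite invgM -(mulgA (gs i) z) -zC !mulgA mulgK.
have x1 : x = 1.
  apply: (lam_eq0 e_sym e_irr) => a.
  have := level_equivariant hk gk x a; rewrite xE -!mulgA mulVg mulg1.
  have [<-|ia] := eqVneq i a; first by rewrite (eqP E) hk; lia.
  rewrite /level mulgA (@lam_vpowr _ _ e_sym e_irr a i false) // -/(level a h) hk; lia.
have v1 : v i = 1.
  apply: (@mulgI _ h); apply: (@mulIg _ h^-1).
  by rewrite -xE x1 (morph1 phiM) mulg1 mulgV.
have := @lam_vpowl _ _ e_sym e_irr i false 1.
by rewrite /= v1 mulg1 (lam1 e_sym e_irr).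
Qed.
End Phi.
End Conjugators.

(** * Automorphisms as functions *)

Section Automorphisms.
Variable G : groupType.
Implicit Types f g : automorphism G.

Lemma automorphismP f g : f =1 g -> f = g.
Proof.
case: f g => [f fM fB] [g gM gB] /= /funext fg; rewrite fg in fM fB *.
by congr Automorphism; apply: Prop_irrelevance.
Qed.

Lemma automorphismVK f : cancel f f^-1.
Proof. by move=> x; rewrite -[LHS]/((f^-1 * f) x) mulVg. Qed.

Lemma automorphismKV f : cancel f^-1 f.
Proof. by move=> x; rewrite -[LHS]/((f * f^-1) x) mulgV. Qed.

End Automorphisms.

(** * Partial conjugations *)

Section PartialConjugations.
Variables (N : nat) (e : rel 'I_N).
Hypotheses (e_sym : symmetric e) (e_irr : irreflexive e).
Local Notation W := (raag e).
Local Notation v := (raag_gen e).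
Local Notation vpow := (vpow e).
Local Notation lam := (@lam N e).
Implicit Types (a c i j : 'I_N) (B : {set 'I_N}) (phi : automorphism W).

Lemma raag_automorphismP (f g : automorphism W) :
  (forall i, f (v i) = g (v i)) -> f = g.
Proof.
move=> fg; apply: automorphismP.
by apply: presented_morph_eq => //; exact: automM.
Qed.

(** Boolean, because it selects the alphabet; closure under edges outside the star stands in for
    components. *)
Definition union_of_components a B : bool :=
  (B \subset ~: star e a) &&
  [forall j, forall k, [&& j \notin star e a, k \notin star e a & e j k] ==>
    ((j \in B) == (k \in B))].

Lemma union_of_componentsP a B : union_of_components a B ->
  (forall j, j \in B -> j \notin star e a) /\
  (forall j k, j \notin star e a -> k \notin star e a -> e j k ->
    (j \in B) = (k \in B)).
Proof.
move=> /andP[/fintype.subsetP sB /forallP cB]; split=> [j /sB|j k ja ka ejk].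
  by rewrite finset.in_setC.
by apply/eqP; have /forallP/(_ k) := cB j; rewrite ja ka ejk.
Qed.

Definition partial_conj a B b i : W :=
  if i \in B then vpow a b * v i * (vpow a b)^-1 else v i.

(** An edge leaving [B] ends in the star of [a], so its outer end commutes with [v a] and the
    relation survives conjugating the other end alone. *)
Lemma partial_conj_rel a B b (u w : word 'I_N) : union_of_components a B ->
  raag_rel e u w ->
  word_eval (partial_conj a B b) u = word_eval (partial_conj a B b) w.
Proof.
move=> /union_of_componentsP[Bout Bc] [j [k [ejk -> ->]]] /=; rewrite !mulg1.
have jk : commute (v j) (v k) by apply: gen_commute; apply: adj_star.
have ak i l : l \notin star e a -> i \in star e a -> e i l -> commute (vpow a b) (v i).
  move=> la ia eil; suff : commute (v a) (v i).
    by move/commute_sym => ?; apply: commute_sym; case: (b) => //=; apply: commuteV.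
  exact: gen_commute.
rewrite /partial_conj; case: ifPn => jB; case: ifPn => kB //.
- by rewrite !mulg_conj jk.
- have ka : k \in star e a.
    apply/negPn/negP => ka; have := Bc j k (Bout _ jB) ka ejk.
    by rewrite jB (negPf kB).
  have := ak k j (Bout _ jB) ka; rewrite e_sym => /(_ ejk) C.
  have C' : commute (vpow a b)^-1 (v k) by apply/commute_sym/commuteV/commute_sym.
  by rewrite -!mulgA C' !mulgA -(mulgA _ (v j)) jk !mulgA -(C : _ = _).
- have ja : j \in star e a.
    apply/negPn/negP => ja; have := Bc j k ja (Bout _ kB) ejk.
    by rewrite kB (negPf jB).
  have C := ak j k (Bout _ kB) ja ejk.
  have C' : commute (vpow a b)^-1 (v j) by apply/commute_sym/commuteV/commute_sym.
  by rewrite !mulgA -C -(mulgA _ (v j)) jk -!mulgA C'.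
Qed.

Lemma partial_conj_exists a B : union_of_components a B ->
  exists f : automorphism W, forall i, f (v i) = partial_conj a B false i.
Proof.
move=> cB; pose F b := @presented_lift _ (raag_rel e) _ (partial_conj a B b).
have FM b : {morph F b : x y / x * y}.
  by apply: presented_liftM => u w; exact: partial_conj_rel.
have FE b i : F b (v i) = partial_conj a B b i.
  by apply: presented_lift_gen => u w; exact: partial_conj_rel.
have [Bout _] := union_of_componentsP cB.
have Fa b : F b (v a) = v a.
  by rewrite FE /partial_conj ifN //; apply: contraTN (star_refl e a) => /Bout.
have FK b : cancel (F b) (F (~~ b)).
  apply: presented_morph_eq => // [x y|i]; first by rewrite !FM.
  have Fp t : F (~~ b) (vpow a t) = vpow a t by case: t; rewrite /= ?(morphV (FM _)) Fa.
  rewrite FE {1}/partial_conj; case: ifPn => iB.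
    rewrite !FM (morphV (FM _)) Fp FE /partial_conj iB vpow_negb invgK.
    by rewrite !mulgA mulgV mul1g mulgK.
  by rewrite FE /partial_conj (negPf iB).
have Fb : bijective (F false) by exists (F true); [exact: (FK false)|exact: (FK true)].
by exists (Automorphism (FM false) Fb) => i; exact: FE.
Qed.

(* Equal to [1] unless [B] is a union of components. *)
Definition chi a B : automorphism W :=
  xget 1 [set f : automorphism W | forall i, f (v i) = partial_conj a B false i]%classic.

Definition letter (l : 'I_N * {set 'I_N} * bool) : automorphism W :=
  if l.2 then (chi l.1.1 l.1.2)^-1 else chi l.1.1 l.1.2.

Lemma chiE a B i : union_of_components a B ->
  chi a B (v i) = partial_conj a B false i.
Proof.
move=> /partial_conj_exists [f fE].
have : [set f : automorphism W | forall i, f (v i) = partial_conj a B false i]%classic (chi a B).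
  by apply: xgetPex; exists f.
exact.
Qed.

Lemma letterE a B b i : union_of_components a B ->
  letter (a, B, b) (v i) = partial_conj a B b i.
Proof.
move=> cB; case: b => /=; last exact: chiE.
have [Bout _] := union_of_componentsP cB.
apply: (can_inj (automorphismVK (chi a B))); rewrite automorphismKV.
have ca : chi a B (v a) = v a.
  by rewrite chiE // /partial_conj ifN //; apply: contraTN (star_refl e a) => /Bout.
rewrite /partial_conj; case: ifPn => iB; last by rewrite chiE // /partial_conj (negPf iB).
have cM := @automM _ (chi a B).
rewrite !cM !(morphV cM) ca chiE // /partial_conj iB /= invgK.
by rewrite !mulgA mulVg mul1g mulgVK.
Qed.

Lemma letterV a B b : (letter (a, B, b))^-1 = letter (a, B, ~~ b).
Proof. by case: b => //=; rewrite invgK. Qed.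

Lemma Aut0P phi : Aut0 e phi <-> exists g, conjugators phi g.
Proof.
split=> [/boolp.choice[g gE]|[g [_ gE]] i]; last by exists (g (Some i)).
by exists (fun i : option _ => if i is Some j then g j else 1).
Qed.

Definition inB B (i : option 'I_N) := if i is Some j then j \in B else false.

(** Since [phi] is applied after the letter, the conjugators over [B] are multiplied on the left by
    [phi (v a)^{±1}]: a move across a wall of [phi (v a)]. *)
Definition rotate phi a B b (g : option 'I_N -> W) (i : option 'I_N) : W :=
  if inB B i then phi (vpow a b) * g i else g i.

Lemma conjugators_letter phi g a B b : union_of_components a B ->
  conjugators phi g -> conjugators (phi * letter (a, B, b)) (rotate phi a B b g).
Proof.
move=> cB [g0 gE]; split=> [|i]; first by rewrite /rotate.
rewrite -[LHS]/(phi (letter (a, B, b) (v i))) letterE // /partial_conj /rotate /=.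
have phiM := @automM _ phi.
by case: ifP => _; rewrite ?phiM ?(morphV phiM) gE // !invgM !mulgA.
Qed.

Lemma Aut0_subgroup : is_subgroup (Aut0 e).
Proof.
split=> [|f g]; rewrite ?inE.
  by apply/Aut0P; exists (fun=> 1); split=> // i; rewrite mul1g invg1 mulg1.
move=> /Aut0P[x [_ fx]] /Aut0P[y [_ gy]] i.
have gM := @automM _ g; have gVM := @automM _ g^-1; have fM := @automM _ f.
exists (f (g^-1 (y (Some i)))^-1 * x (Some i)).
have -> : (f * g^-1) (v i) = f (g^-1 (v i)) by [].
have -> : g^-1 (v i) = (g^-1 (y (Some i)))^-1 * v i * g^-1 (y (Some i)).
  apply: (can_inj (automorphismVK g)).
  rewrite automorphismKV !gM (morphV gM) !automorphismKV gy.
  by rewrite !mulgA mulVg mul1g mulgVK.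
by rewrite !fM fx !invgM !(morphV fM) invgK !mulgA.
Qed.

End PartialConjugations.

(** * The automaton *)

Section States.
Variables (N : nat) (e : rel 'I_N).
Hypotheses (e_sym : symmetric e) (e_irr : irreflexive e).
(* [None] is the base point, taken into account only if [rooted]; the points at
   the level of [ref a] are never moved by [a]. *)
Variables (rooted : bool) (ref : 'I_N -> option 'I_N).
Local Notation W := (raag e).
Local Notation v := (raag_gen e).
Local Notation vpow := (vpow e).
Local Notation lam := (@lam N e).
Local Notation ev := (presented_class (raag_rel e)).
Implicit Types (a c : 'I_N) (i j : option 'I_N) (B : {set 'I_N}).
Implicit Types (phi : automorphism W) (g : option 'I_N -> W).

(** For a vertex in the star of [a] the level at [a] would depend on the chosen conjugator. *)
Definition visible a i : bool := if i is Some k then k \notin star e a else rooted.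

Hypothesis ref_visible : forall a i, visible a i -> visible a (ref a).
Hypothesis ref_rooted : forall a, rooted -> ref a = None.

Definition lev g a i : int := level g a (g i).

(** Levels are unbounded, but their order at each generator is a finite table. *)
Definition state : finType := {ffun 'I_N * option 'I_N * option 'I_N -> bool}.

Definition state_of g : state :=
  [ffun x => [&& visible x.1.1 x.1.2, visible x.1.1 x.2 &
                 (lev g x.1.1 x.1.2 <= lev g x.1.1 x.2)%R]].

Lemma state_ofE g a i j : visible a i -> visible a j ->
  state_of g (a, i, j) = (lev g a i <= lev g a j)%R.
Proof. by move=> ai aj; rewrite ffunE /= ai aj. Qed.

Lemma lev_rotate_self phi g a B b i : conjugators phi g ->
  union_of_components e a B ->
  lev (rotate phi a B b g) a i = (lev g a i + (if inB B i then sgb b else 0))%R.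
Proof.
move=> gE /union_of_componentsP[Bout _].
have aB : a \notin B by apply: contraTN (star_refl e a) => /Bout.
rewrite /lev {1}/rotate /level /rotate /= (negPf aB); case: ifP => _.
  by rewrite -/(level g a _) (level_phi e_sym e_irr (@automM _ phi) gE) GRing.addrC.
by rewrite GRing.addr0.
Qed.

(* After the points of [B] have been moved across a wall of [a], a point that has
   not moved together with [c] lies, seen from [c], behind the walls of [a]. *)
Definition via a B c i : option 'I_N :=
  if [|| inB B i == (c \in B), a \in star e c |
         if i is Some k then k \in star e a else false]
  then i else Some a.

(** By the last hypothesis [B] is extremal at [a], so the move puts a wall of [a] between [B] and
    the other points visible at [a]; [level_sep] then replaces a separated point by [a]. *)
Lemma lev_rotate_other phi g a B b c i : conjugators phi g ->
  union_of_components e a B -> c != a -> visible c i ->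
  (forall j k, inB B j -> visible a k -> (0 <= sgb b * (lev g a j - lev g a k))%R) ->
  lev (rotate phi a B b g) c i = lev g c (via a B c i).
Proof.
move=> gE /union_of_componentsP[Bout _] ca ci ext.
have phiM := @automM _ phi.
rewrite /lev /via; case: (boolP (a \in star e c)) => [ac|nac].
  have eca : e c a by move: ac; rewrite inE eq_sym (negPf ca).
  have cB : c \notin B by apply: contraTN ac => /Bout; rewrite (star_sym e_sym).
  rewrite orbT /rotate /level /= (negPf cB); case: ifP => // _.
  exact: (level_phi_adj e_sym e_irr phiM gE).
have nca : c \notin star e a by rewrite (star_sym e_sym).
(* If [c] has moved, its walls have moved along, and the point is pulled back instead. *)
have levB h : level (rotate phi a B b g) c h =
    if c \in B then level g c (phi (vpow a (~~ b)) * h) else level g c h.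
  rewrite /level /rotate /=; case: ifP => // _.
  by rewrite invgM vpow_negb (morphV phiM) mulgA.
have self k : phi (vpow a (~~ b)) * (phi (vpow a b) * k) = k.
  by rewrite vpow_negb (morphV phiM) mulKg.
rewrite levB orFb {1 2}/rotate; case iB: (inB B i); case cB: (c \in B) => //=.
- by rewrite self.
- have ia : (if i is Some k then k \in star e a else false) = false.
    by case: (i) iB => //= k /Bout/negPf.
  rewrite ia; apply: (level_sep e_sym e_irr nca).
  rewrite (level_phi e_sym e_irr phiM gE) => E.
  have := ext i (Some c) iB nca; rewrite /lev -E.
  by case: (b) => /=; lia.
- case: (boolP (if i is Some k then k \in star e a else false)) => ia.
    case: i ia ci {iB} => //= k ka kc.
    have ck : c \notin star e k by rewrite (star_sym e_sym).
    have ak : a \in star e k by rewrite (star_sym e_sym).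
    have := conj_special e_sym e_irr phiM gE (~~ b) ak.
    by move/(level_special e_sym e_irr g (g (Some k)) ck); rewrite mulVKg.
  apply: (level_sep e_sym e_irr nca).
  have vi : visible a i by case: (i) ia ci.
  rewrite (level_phi e_sym e_irr phiM gE) => E.
  have := ext (Some c) i cB vi; rewrite /lev -E.
  by case: (b) => /=; lia.
Qed.

(** At [a] itself the extremal set [B] becomes strictly extremal, so membership in [B] settles every
    comparison that involves it. *)
Definition next_state (T : state) (l : 'I_N * {set 'I_N} * bool) : state :=
  let: (a, B, b) := l in
  [ffun x => let: (c, i, j) := x in [&& visible c i, visible c j &
    if c != a then T (c, via a B c i, via a B c j)
    else if b then inB B i || ~~ inB B j && T (a, i, j)
    else inB B j || ~~ inB B i && T (a, i, j)]].

Definition appendable (T : state) (l : 'I_N * {set 'I_N} * bool) : bool :=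
  let: (a, B, b) := l in
  [forall i, forall j, (inB B i && visible a j) ==>
     if b then T (a, i, j) else T (a, j, i)].

Lemma visible_inB a B i : union_of_components e a B -> inB B i -> visible a i.
Proof. by case: i => //= k /union_of_componentsP[+ _] => /[apply]. Qed.

Lemma appendableP g a B b : union_of_components e a B ->
  reflect (forall i j, inB B i -> visible a j -> (0 <= sgb b * (lev g a i - lev g a j))%R)
    (appendable (state_of g) (a, B, b)).
Proof.
move=> cB; apply: (iffP forallP) => [H i j iB aj|H i].
  have ai := visible_inB cB iB.
  have /forallP/(_ j) := H i; rewrite iB aj /=.
  by case: (b) => /=; rewrite state_ofE //=; lia.
apply/forallP => j; apply/implyP => /andP[iB aj]; have ai := visible_inB cB iB.
by have := H i j iB aj; case: (b) => /=; rewrite state_ofE //=; lia.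
Qed.

Lemma via_visible a B c i : visible c i -> visible c (via a B c i).
Proof. by rewrite /via; case: ifP => //= /norP[_ /norP[]]. Qed.

Lemma state_of_rotate phi g a B b : conjugators phi g ->
  union_of_components e a B -> appendable (state_of g) (a, B, b) ->
  state_of (rotate phi a B b g) = next_state (state_of g) (a, B, b).
Proof.
move=> gE cB /(appendableP _ _ cB) ext; apply/ffunP => -[[c i] j].
rewrite [LHS]ffunE [RHS]ffunE /=; case ci: (visible c i) => //=; case cj: (visible c j) => //=.
have [ca|ca] := eqVneq c a; last first.
  by rewrite /= !(lev_rotate_other gE cB ca _ ext) // state_ofE //; apply: via_visible.
rewrite /= {c}ca in ci cj *; rewrite state_ofE // !(lev_rotate_self _ _ gE cB).
have Ei := ext i j; have Ej := ext j i.
case: (inB B i) Ei => [/(_ isT cj)|_]; case: (inB B j) Ej => [/(_ isT ci)|_];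
  by case: (b) => /=; lia.
Qed.

Lemma state_of_indep phi g g' :
  conjugators phi g -> conjugators phi g' -> state_of g = state_of g'.
Proof.
move=> gE gE'; pose d i := (g i)^-1 * g' i.
have dE i : g' i = g i * d i by rewrite mulVKg.
have ds k : special (star e k) (d (Some k)).
  apply: (centralizer_gen e_sym e_irr); apply: (@mulgI _ (g (Some k))).
  by rewrite /d !mulgA -gE.2 gE'.2 mulgVK mulgV mul1g.
have levE a i : visible a i ->
    lev g' a i = (lam a (d (Some a))^-1 + lev g a i)%R.
  move=> ai; rewrite /lev /level !dE invgM -!mulgA.
  rewrite (lam_star_l e_sym e_irr) //; last exact: specialV.
  rewrite mulgA; case: i ai => [k|] /= ak.
    by rewrite (lam_special_r e_sym e_irr _ _ (ds k)) // (star_sym e_sym).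
  by rewrite /d gE.1 gE'.1 invg1 !mulg1.
apply/ffunP => -[[c i] j]; rewrite !ffunE /=.
case ci: (visible c i) => //=; case cj: (visible c j) => //=.
by rewrite !levE //; lia.
Qed.

Definition unsettled (T : state) a :=
  [exists i, visible a i && ~~ (T (a, ref a, i) && T (a, i, ref a))].

(** The lowest level set is taken if some point is below [ref a], the highest otherwise; undoing the
    letter moves it towards [ref a]. *)
Definition last_letter (T : state) : option ('I_N * {set 'I_N} * bool) :=
  if [pick a | unsettled T a] isn't Some a then None
  else if [exists i, visible a i && ~~ T (a, ref a, i)] then
    Some (a, [set k | [forall j, visible a j ==> T (a, Some k, j)]]%SET, true)
  else
    Some (a, [set k | [forall j, visible a j ==> T (a, j, Some k)]]%SET, false).

Lemma last_letter_None g : last_letter (state_of g) = None ->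
  forall a i, visible a i -> lev g a i = lev g a (ref a).
Proof.
rewrite /last_letter; case: pickP => [a _|H _ a i ai]; first by case: ifP.
have := H a; move/negbT; rewrite negb_exists => /forallP/(_ i); rewrite ai /=.
have ar := ref_visible ai.
by rewrite !state_ofE // negbK => /andP[]; lia.
Qed.

Lemma int_extremum (F : option 'I_N -> int) (P : pred (option 'I_N)) i0 : P i0 ->
  exists2 i, P i & forall j, P j -> (F j <= F i)%R.
Proof.
by move=> Pi0; case: (@Order.TotalTheory.arg_maxP _ _ _ i0 P F Pi0) => i Pi H; exists i.
Qed.

Lemma last_letter_Some phi g a B b : conjugators phi g ->
  last_letter (state_of g) = Some (a, B, b) ->
  [/\ union_of_components e a B, B != finset.set0, ~~ inB B (ref a),
   (forall i j, inB B i -> visible a j -> (0 <= sgb b * (lev g a i - lev g a j))%R) &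
   (forall i j, inB B i -> ~~ inB B j -> visible a j ->
     (0 < sgb b * (lev g a i - lev g a j))%R)].
Proof.
move=> gE; have phiM := @automM _ phi.
(* The sign of the letter unites the lowest and the highest case. *)
suff H : last_letter (state_of g) = Some (a, B, b) ->
   [/\ exists2 i, visible a i & (0 < sgb b * (lev g a i - lev g a (ref a)))%R,
     visible a (ref a) &
     forall k, (k \in B) <-> visible a (Some k) /\
     forall j, visible a j -> (0 <= sgb b * (lev g a (Some k) - lev g a j))%R].
  move=> /H[[i1 ai1 li1] ar BE]; split.
  - apply/andP; split.
      by apply/fintype.subsetP => k /BE[]; rewrite finset.in_setC.
    apply/forallP => j; apply/forallP => k; apply/implyP => /and3P[ja ka ejk].
    have E := level_adj e_sym e_irr phiM gE ja ka ejk.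
    apply/eqP; apply/idP/idP => /BE[_ H1]; apply/BE; split=> // l al.
      by rewrite /lev -E; exact: H1.
    by rewrite /lev E; exact: H1.
  (* The extremal point is a vertex: the base point counts only when [rooted], and is then [ref a]
     itself. *)
  - have [i ai Hi] := int_extremum (fun i => sgb b * lev g a i)%R ai1.
    case: i ai Hi => [k|] /= ai Hi; last first.
      by have := Hi _ ai1; move: li1; rewrite ref_rooted //; case: (b) => /=; lia.
    apply/finset.set0Pn; exists k; apply/BE; split=> // j aj.
    by have := Hi _ aj; case: (b) => /=; lia.
  - case E: (ref a) => [k|//]; apply/negP => /= /BE[_ /(_ _ ai1)].
    by move: li1; rewrite E; case: (b) => /=; lia.
  - by case=> // k j /BE[_ H1]; exact: H1.
  - case=> // k j /BE[ak H1] jB aj; have H2 := H1 _ aj.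
    rewrite Order.POrderTheory.lt_neqAle H2 andbT; apply: contraNneq jB => E0.
    have E : lev g a j = lev g a (Some k) by move: E0; case: (b) => /=; lia.
    case: j aj E {H2 E0} => [l|] /= aj E.
      by apply/BE; split=> // j' aj'; rewrite E; exact: H1.
    by have := H1 _ ai1; move: li1; rewrite -E ref_rooted //; case: (b) => /=; lia.
rewrite /last_letter; case: pickP => // c /existsP[i0 /andP[ci0 ni0]].
have cr := ref_visible ci0.
case: ifPn => [/existsP[i1 /andP[ci1 ni1]]|ni1] -[ca <- <-]; subst c.
  rewrite state_ofE // in ni1; split=> //; first by exists i1 => //=; lia.
  move=> k; rewrite inE; split=> [/forallP H|[ak H]].
    have ak : visible a (Some k) by have := H (ref a); rewrite cr /= ffunE => /and3P[].
    by split=> // j aj; have := H j; rewrite aj state_ofE //=; lia.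
  by apply/forallP => j; apply/implyP => aj; have := H j aj; rewrite state_ofE //=; lia.
move: ni1; rewrite negb_exists => /forallP ni1.
have ref_min j : visible a j -> (lev g a (ref a) <= lev g a j)%R.
  by move=> aj; have := ni1 j; rewrite aj /= negbK state_ofE.
split=> //.
  exists i0 => //=; move: ni0; rewrite !state_ofE // ref_min //=; lia.
move=> k; rewrite inE; split=> [/forallP H|[ak H]].
  have ak : visible a (Some k) by have := H (ref a); rewrite cr /= ffunE => /and3P[].
  by split=> // j aj; have := H j; rewrite aj state_ofE //=; lia.
by apply/forallP => j; apply/implyP => aj; have := H j aj; rewrite state_ofE //=; lia.
Qed.

(** * Distances between cosets and termination *)

Definition point phi i (x : W) : Prop :=
  if i is Some k then phi (v k) = x * v k * x^-1 else x = 1.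

Definition within phi i j n : Prop :=
  exists x w, [/\ point phi i x, point phi j (x * ev w) & size w <= n].

Lemma within_exists phi g i j : conjugators phi g -> exists n, `[< within phi i j n >].
Proof.
move=> gE; have gp k : point phi k (g k) by case: k => [k|]; [exact: gE.2|exact: gE.1].
have [w wE] := raag_spell ((g i)^-1 * g j).
by exists (size w); apply/asboolP; exists (g i), w; rewrite -wE mulVKg.
Qed.

Lemma within_sym phi i j n : within phi i j n -> within phi j i n.
Proof.
move=> [x [w [px py sw]]]; exists (x * ev w), (word_inv w).
by rewrite ev_word_inv mulgK size_word_inv.
Qed.

Definition distance phi i j : nat :=
  if pselect (exists n, `[< within phi i j n >]) is left h then ex_minn h else 0.

Lemma distanceP phi g i j : conjugators phi g -> within phi i j (distance phi i j).
Proof.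
move=> gE; rewrite /distance; case: pselect => [h|[]]; last exact: within_exists gE.
by case: ex_minnP => n /asboolP.
Qed.

Lemma distance_le phi i j n : within phi i j n -> distance phi i j <= n.
Proof.
move=> h; rewrite /distance; case: pselect => // h'; case: ex_minnP => m _; apply.
exact/asboolP.
Qed.

Definition spread phi : nat :=
  \sum_(p : option 'I_N * option 'I_N | (isSome p.1 || rooted) && (isSome p.2 || rooted))
    distance phi p.1 p.2.

Lemma level_point phi g a i x : conjugators phi g -> visible a i -> point phi i x ->
  level g a x = lev g a i.
Proof.
move=> gE ai; case: i ai => [k|] /= ai; last by move=> ->; rewrite /lev gE.1.
rewrite gE.2 => E; rewrite -[x](mulVKg (g (Some k))).
apply: (level_special e_sym e_irr g _ (i := k)); first by rewrite (star_sym e_sym).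
apply: (centralizer_gen e_sym e_irr); apply: (@mulgI _ (g (Some k))).
by rewrite !mulgA E mulgVK mulgV mul1g.
Qed.

Section Decrease.
Variables (phi : automorphism W) (g : option 'I_N -> W).
Variables (a : 'I_N) (B : {set 'I_N}) (b : bool).
Hypotheses (gE : conjugators phi g) (cB : union_of_components e a B).
Hypothesis ext : forall i j, inB B i -> ~~ inB B j -> visible a j ->
  (0 < sgb b * (lev g a i - lev g a j))%R.
Let psi := phi * letter e (a, B, ~~ b).
Let u := phi (vpow a (~~ b)).
Let in_star i := if i is Some k then k \in star e a else false.

Let point_fixed i x : ~~ inB B i -> point phi i x -> point psi i x.
Proof.
case: i => // k /= kB <-.
by rewrite -[LHS]/(phi (letter e (a, B, ~~ b) (v k))) letterE // /partial_conj (negPf kB).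
Qed.

Let point_moved i x : inB B i || in_star i -> point phi i x -> point psi i (u * x).
Proof.
have phiM := @automM _ phi.
case: i => // k /= kB kx.
rewrite -[LHS]/(phi (letter e (a, B, ~~ b) (v k))) letterE // /partial_conj.
have E y : u * x * y * (u * x)^-1 = u * (x * y * x^-1) * u^-1.
  by rewrite invgM !mulgA.
rewrite E -kx /u; case: ifP kB => kB /= ka.
  by rewrite !phiM (morphV phiM).
have : commute (vpow a (~~ b)) (v k).
  by apply: special_star_vpow; exact: (@special_vpow _ e _ k false).
by move=> /(phi_commute phiM) ->; rewrite mulgK.
Qed.

Lemma within_letter i j n : isSome i || rooted -> isSome j || rooted ->
  within phi i j n ->
  within psi i j (n - (inB B i && visible a j && ~~ inB B j)).
Proof.
move=> vi vj.
(* A path from a fixed coset to a moved one crosses a wall of [a]; deleting the crossing letter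
   makes it end in the rotated coset. *)
have H k l m : isSome l || rooted -> inB B k -> ~~ inB B l -> ~~ in_star l ->
    within phi l k m -> within psi l k m.-1.
  move=> vl kB lB ls [x [w [px py sw]]].
  have al : visible a l by case: (l) vl ls.
  have ak : visible a k by apply: visible_inB cB kB.
  have [|w' sw' E] := @cross_shorten _ _ e_sym e_irr a b (g (Some a)) x w.
    rewrite -!/(level g a _) (level_point gE ak py) (level_point gE al px).
    exact: ext.
  exists x, w'; split; [exact: point_fixed| |by move: (leq_trans sw' sw); case: (m)].
  rewrite E -(phi_vpow (@automM _ phi) gE) -(morphV (@automM _ phi)) -vpow_negb.
  by apply: point_moved; rewrite ?kB.
move=> Wij; have [iB|iB] := boolP (inB B i); last first.
  rewrite /= subn0; have [jB|jB] := boolP (inB B j); last first.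
    by case: Wij => x [w [px py sw]]; exists x, w; split=> //; exact: point_fixed.
  (* The coset of a vertex in the star of [a] is preserved by [u], so the whole path can be
     rotated. *)
  have [si|si] := boolP (in_star i).
    case: Wij => x [w [px py sw]]; exists (u * x), w; rewrite -mulgA.
    by split=> //; apply: point_moved; rewrite ?jB ?si ?orbT.
  have [x [w [px py sw]]] := H _ _ _ vi jB iB si Wij.
  by exists x, w; split=> //; apply: leq_trans sw (leq_pred _).
have [js|js] := boolP (inB B j || in_star j).
  have -> : visible a j && ~~ inB B j = false.
    case: j js {vj Wij} => // k /= /orP[->|ks]; first by rewrite andbF.
    by rewrite ks.
  rewrite /= subn0; case: Wij => x [w [px py sw]]; exists (u * x), w; rewrite -mulgA.
  by split=> //; apply: point_moved; rewrite ?iB.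
move: js; rewrite negb_or => /andP[jB js].
have -> : visible a j by case: (j) vj js.
by rewrite jB subn1; apply/within_sym/(H _ _ _ vj iB jB js)/within_sym.
Qed.

Lemma spread_letter i : inB B i -> ~~ inB B (ref a) -> spread psi < spread phi.
Proof.
move=> iB rB; have ai := visible_inB cB iB; have ar := ref_visible ai.
have act k : visible a k -> isSome k || rooted by case: k.
have le k l : isSome k || rooted -> isSome l || rooted ->
    distance psi k l <= distance phi k l - (inB B k && visible a l && ~~ inB B l).
  by move=> vk vl; apply: distance_le; apply: within_letter => //; exact: distanceP gE.
(* A common point of the two cosets would have two different levels at [a]. *)
have pos : 0 < distance phi i (ref a).
  rewrite lt0n; apply/negP => /eqP d0.
  have [x [w [px py]]] := distanceP i (ref a) gE; rewrite d0 leqn0 => /nilP w0.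
  move: py; rewrite w0 mulg1 => py.
  have := ext iB rB ar.
  by rewrite -(level_point gE ai px) -(level_point gE ar py) GRing.subrr GRing.mulr0.
rewrite /spread (bigD1 (i, ref a)) /=; last by rewrite !act.
rewrite [ltnRHS](bigD1 (i, ref a)) /=; last by rewrite !act.
rewrite -addSn leq_add //.
  have := le i (ref a) (act _ ai) (act _ ar); rewrite iB ar rB.
  by rewrite subn1 -ltnS prednK.
apply: leq_sum => -[k l] /andP[/andP[vk vl] _] /=.
exact: leq_trans (le _ _ vk vl) (leq_subr _ _).
Qed.

End Decrease.

End States.

(** * Normal forms for [Aut0] *)

Section NormalForms.
Variables (N : nat) (e : rel 'I_N).
Hypotheses (e_sym : symmetric e) (e_irr : irreflexive e).
Local Notation W := (raag e).
Local Notation v := (raag_gen e).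
Local Notation vpow := (vpow e).
Local Notation lam := (@lam N e).
Implicit Types (a c : 'I_N) (B S : {set 'I_N}).
Implicit Types (phi : automorphism W) (g : option 'I_N -> W).

Lemma gen_notin_special S a : a \notin S -> ~ special S (v a).
Proof.
move=> aS; rewrite /special retr_gen (negPf aS) => v1.
have := lam_vpowl e_sym e_irr a false 1.
by rewrite /= -v1 mulg1 (lam1 e_sym e_irr).
Qed.

(** [B] consists of the vertices that are not fixed. For [i] in [B], the quotient [(v a')^-1 * v a]
    centralizes [v i], yet the retraction onto the star of [i] kills it. *)
Lemma chi_inj a B a' B' :
  union_of_components e a B -> B != finset.set0 ->
  union_of_components e a' B' -> B' != finset.set0 ->
  chi e a B = chi e a' B' -> (a, B) = (a', B').
Proof.
have chi_neq c C i : union_of_components e c C -> i \in C -> chi e c C (v i) <> v i.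
  move=> cC iC; rewrite (chiE e_sym) // /partial_conj iC => E.
  have [/(_ i iC) ic _] := union_of_componentsP cC.
  apply: (@gen_notin_special (star e i) c); first by rewrite (star_sym e_sym).
  apply: (centralizer_gen e_sym e_irr).
  by rewrite /commute -{1}E mulgVK.
move=> cB nB cB' nB' E.
have BB : B = B'.
  apply/finset.setP => i; apply/idP/idP => iB; apply/negPn/negP => iB'.
    by apply: (chi_neq _ _ _ cB iB); rewrite E (chiE e_sym) // /partial_conj (negPf iB').
  by apply: (chi_neq _ _ _ cB' iB); rewrite -E (chiE e_sym) // /partial_conj (negPf iB').
subst B'; congr (_, _); have [i iB] := finset.set0Pn _ nB.
have := congr1 (fun f : automorphism W => f (v i)) E.
rewrite /= !(chiE e_sym) // /partial_conj iB /= => E'.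
have [/(_ i iB) ia _] := union_of_componentsP cB.
have [/(_ i iB) ia' _] := union_of_componentsP cB'.
have C : commute (v i) ((v a')^-1 * v a).
  apply: (@mulgI _ (v a')); apply: (@mulIg _ (v a)^-1).
  by rewrite !mulgA mulgK mulgV mul1g E'.
have := centralizer_gen e_sym e_irr C.
rewrite /special retrM retrV !retr_gen.
rewrite !(star_sym e_sym _ i) (negPf ia) (negPf ia') invg1 mul1g => E1.
apply/eqP/negPn/negP => aa'.
apply: (@gen_notin_special [set a']%SET a); first by rewrite inE.
have -> : v a = v a' by rewrite -[v a](mulVKg (v a')) -E1 mulg1.
by rewrite /special retr_gen inE eqxx.
Qed.

Section Core.
Variables (rooted : bool) (ref : 'I_N -> option 'I_N).
Hypothesis ref_visible : forall a i, visible e rooted a i -> visible e rooted a (ref a).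
Hypothesis ref_rooted : forall a, rooted -> ref a = None.

Definition some_conjugators phi : option 'I_N -> W :=
  if pselect (exists g, conjugators phi g) is left h then sval (cid h) else fun=> 1.

Lemma some_conjugatorsP phi : Aut0 e phi -> conjugators phi (some_conjugators phi).
Proof.
move=> /Aut0P H; rewrite /some_conjugators; case: pselect => // h.
by case: (cid h).
Qed.

Definition admissible (x : 'I_N * {set 'I_N}) : bool :=
  [&& union_of_components e x.1 x.2, x.2 != finset.set0 & ~~ inB x.2 (ref x.1)].

Lemma last_letter_settled g :
  (forall a i, visible e rooted a i -> lev g a i = lev g a (ref a)) ->
  last_letter e rooted ref (state_of rooted g) = None.
Proof.
move=> H; rewrite /last_letter; case: pickP => // a /existsP[i /andP[ai]].
by rewrite !state_ofE // ?(ref_visible ai) // (H a i ai) Order.POrderTheory.lexx.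
Qed.

Variable H : set (automorphism W).
Hypothesis H_subgroup : is_subgroup H.
Hypothesis H_Aut0 : (H `<=` Aut0 e)%classic.
Hypothesis H_chi : forall a B, admissible (a, B) -> H (chi e a B).
Hypothesis H_settled : forall phi g, H phi -> conjugators phi g ->
  (forall a i, visible e rooted a i -> lev g a i = lev g a (ref a)) -> phi = 1.

Lemma normal_forms_of_settled : has_regular_normal_forms H.
Proof.
pose st phi := state_of rooted (some_conjugators phi).
have stE phi g : Aut0 e phi -> conjugators phi g -> st phi = state_of rooted g.
  by move=> /some_conjugatorsP h1 h2; exact: (state_of_indep e_sym e_irr rooted h1 h2).
have letter_Aut0 phi a B b : union_of_components e a B -> Aut0 e phi ->
    Aut0 e (phi * letter e (a, B, b)).
  move=> cB /Aut0P[g gE]; apply/Aut0P; exists (rotate phi a B b g).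
  exact: conjugators_letter.
apply: (@regular_normal_forms_criterion _ H _ admissible (fun x => chi e x.1 x.2) _ st
  (last_letter e rooted ref) (@next_state _ e rooted) (@appendable _ e rooted)
  (spread (e := e) rooted)) => //.
- by case=> a B; exact: H_chi.
- move=> [a B] [a' B'] /and3P[/= c1 n1 _] /and3P[/= c2 n2 _]; exact: chi_inj.
- move=> h Hh; split=> [|->].
    have hA := some_conjugatorsP (H_Aut0 Hh).
    move/(last_letter_None ref_visible); exact: H_settled hA.
  have c1 : conjugators (1 : automorphism W) (fun=> 1).
    by split=> // i; rewrite mul1g invg1 mulg1.
  rewrite (stE _ _ _ c1); last by apply/Aut0P; exists (fun=> 1).
  by apply: last_letter_settled => a i _; rewrite /lev.
- move=> phi [[a B] b] /H_Aut0 A la; have gE := some_conjugatorsP A.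
  have [cB nB rB ext sext] := last_letter_Some e_sym e_irr ref_visible ref_rooted gE la.
  rewrite -/(letter e (a, B, b)) letterV; split.
  + by rewrite /admissible /= cB nB rB.
  + rewrite (stE _ (rotate phi a B (~~ b) (some_conjugators phi))).
    (* [B] was strictly beyond the other points, so one step back leaves it extremal. *)
    * apply/appendableP => // i j iB aj.
      have := ext i j iB aj; have := sext i j iB; rewrite !(lev_rotate_self e_sym e_irr _ _ gE) //.
      rewrite iB; case: (inB B j) => /=; first by move=> _; case: (b) => /=; lia.
      by move=> /(_ isT aj) + _; case: (b) => /=; lia.
    * exact: letter_Aut0.
    * exact: conjugators_letter.
  + have [i iB] := finset.set0Pn _ nB.
    by apply: (@spread_letter _ _ e_sym e_irr _ _ ref_visible _ _ _ _ _ gE cB sext (Some i)).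
- move=> phi [[a B] b] /H_Aut0 A /and3P[cB _ _] ap; have gE := some_conjugatorsP A.
  have {}cB : union_of_components e a B := cB.
  rewrite -/(letter e (a, B, b)).
  have := state_of_rotate e_sym e_irr gE cB ap; rewrite -/(st phi) => <-.
  apply: stE; [exact: letter_Aut0|exact: conjugators_letter].
Qed.

End Core.

Lemma Aut0_normal_forms : has_regular_normal_forms (Aut0 e).
Proof.
apply: (@normal_forms_of_settled true (fun=> None)) => //.
- exact: Aut0_subgroup.
- move=> a B /and3P[/= cB _ _]; apply/Aut0P.
  have c1 : conjugators (1 : automorphism W) (fun=> 1).
    by split=> // i; rewrite mul1g invg1 mulg1.
  exists (rotate (1 : automorphism W) a B false (fun=> 1)).
  by have := conjugators_letter e_sym false cB c1; rewrite mul1g.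
- move=> phi g _ gE settled; apply: raag_automorphismP => i.
  have phiM := @automM _ phi.
  have onto y : exists x, phi x = y by exists (phi^-1 y); exact: automorphismKV.
  (* The identity is the base point and shares the levels of all visible points, so it can serve as
     [h]. *)
  rewrite (@level_inner _ _ e_sym e_irr phi g phiM gE 1 (fun a => level g a 1)) //.
    by rewrite mul1g invg1 mulg1.
  by move=> a c ca; have := settled a (Some c) ca; rewrite /lev gE.1.
Qed.

End NormalForms.

(** * [Out0] and inner automorphisms *)

Section Out0.
Variables (N : nat) (e : rel 'I_N).
Hypotheses (e_sym : symmetric e) (e_irr : irreflexive e).
Local Notation W := (raag e).
Local Notation v := (raag_gen e).
Local Notation vpow := (vpow e).
Local Notation lam := (@lam N e).
Implicit Types (a c i j : 'I_N) (B S : {set 'I_N}) (x y : W).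
Implicit Types (phi : automorphism W) (g : option 'I_N -> W).

Definition first_outside a : option 'I_N :=
  [pick j | (j \notin star e a) && [forall k, (k \notin star e a) ==> (j <= k)]].

Lemma first_outsideP a j : is_min_outside_star e a j <-> first_outside a = Some j.
Proof.
rewrite /first_outside; split=> [[ja mj]|].
  case: pickP => [k /andP[ka /forallP mk]|/(_ j)]; last first.
    by rewrite ja; move/forallP; case=> k; apply/implyP/mj.
  congr Some; apply/val_inj/eqP; rewrite /= eqn_leq (mj k ka) andbT.
  by have := mk j; rewrite ja.
case: pickP => // k /andP[ka /forallP mk] [<-]; split=> // l la.
by have := mk l; rewrite la.
Qed.

Lemma first_outside_visible a (i : option 'I_N) :
  visible e false a i -> visible e false a (first_outside a).
Proof.
case: i => // k ka; case E: (first_outside a) => [j|].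
  by have [] := (first_outsideP a j).2 E.
move: E; rewrite /first_outside; case: pickP => // + _.
have [j ja mj] := @arg_minnP _ k (fun j => j \notin star e a) val ka.
move/(_ j); rewrite ja => /forallP; case=> l; apply/implyP; exact: mj.
Qed.

(** Induction on the size of [B]: splitting off the component [K] of one of its points splits off a
    factor in [P0]. *)
Lemma chi_Out0 a B : union_of_components e a B ->
  ~~ inB B (first_outside a) -> Out0 e (chi e a B).
Proof.
elim: {B}#|B|.+1 {-2}B (ltnSn #|B|) => // n IH B sB cB jB.
have [O1 OV] := generated_subgroup (P0 e); rewrite inE in O1.
have OM f h : Out0 e f -> Out0 e h -> Out0 e (f * h).
  move=> Of Oh; rewrite -[h]invgK.
  have OhV : Out0 e h^-1 by have := OV 1 h; rewrite !inE mul1g; apply.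
  by have := OV f h^-1; rewrite !inE; apply.
have [Bout Bc] := union_of_componentsP cB.
have [B0|/finset.set0Pn[x xB]] := eqVneq B finset.set0.
  suff -> : chi e a B = 1 by [].
  by apply: raag_automorphismP => i; rewrite (chiE e_sym) // /partial_conj B0 inE.
have xa := Bout x xB.
pose K := [set y | connect (outside_star e a) x y]%SET.
have xK : x \in K by rewrite inE connect0.
have KB : K \subset B.
  apply/fintype.subsetP => y; rewrite inE => xy.
  have clB : closed (outside_star e a) B.
    by move=> j k /and3P[ja ka ejk]; exact: Bc.
  by rewrite -(closed_connect clB xy).
have Kc j k : j \notin star e a -> k \notin star e a -> e j k -> (j \in K) = (k \in K).
  move=> ja ka ejk; rewrite !inE; apply/idP/idP => h; apply: connect_trans h (connect1 _).
    exact/and3P.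
  by apply/and3P; rewrite e_sym.
have cK : union_of_components e a K.
  apply/andP; split.
    apply/fintype.subsetP => y /(fintype.subsetP KB) /Bout.
    by rewrite finset.in_setC.
  apply/forallP => j; apply/forallP => k; apply/implyP => /and3P[ja ka ejk].
  by apply/eqP; exact: Kc.
have cD : union_of_components e a (B :\: K).
  apply/andP; split.
    apply/fintype.subsetP => y; rewrite !inE => /andP[_ /Bout]; by rewrite !inE.
  apply/forallP => j; apply/forallP => k; apply/implyP => /and3P[ja ka ejk].
  by rewrite !finset.in_setD (Kc j k) // (Bc j k).
have -> : chi e a B = chi e a (B :\: K) * chi e a K.
  apply: raag_automorphismP => i.
  rewrite -[RHS]/(chi e a (B :\: K) (chi e a K (v i))) !(chiE e_sym) //.
  have aD : chi e a (B :\: K) (v a) = v a.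
    rewrite (chiE e_sym) // /partial_conj ifN // finset.in_setD negb_and.
    by rewrite orbC; apply/orP; left; apply: contraTN (star_refl e a) => /Bout.
  rewrite /partial_conj; case iK: (i \in K).
    have dM := @automM _ (chi e a (B :\: K)).
    rewrite (fintype.subsetP KB) // !dM (morphV dM) aD (chiE e_sym) //.
    by rewrite /partial_conj finset.in_setD iK.
  by rewrite (chiE e_sym) // /partial_conj finset.in_setD iK.
apply: OM.
  apply: IH => //.
    apply: leq_trans (_ : #|B| <= n); last by rewrite -ltnS.
    apply: proper_card; apply/fintype.properP; split; first exact: finset.subsetDl.
    by exists x => //; rewrite finset.in_setD xK.
  by case: (first_outside a) jB => //= j jB; rewrite finset.in_setD negb_and jB orbT.
apply: sub_gen_smallest.
have := @first_outside_visible a (Some x) xa.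
case E: (first_outside a) jB => [j|] //= jB ja.
exists a, j, K; split.
- exact/first_outsideP.
- by exists x.
- by apply: contraNN jB => /(fintype.subsetP KB).
- by move=> k; rewrite (chiE e_sym).
Qed.

(** After killing the generators outside [S], such a [phi] fixes [v j]; this restricts the inner
    automorphisms in [Out0]. *)
Definition conj_trivially S j phi : Prop :=
  Aut0 e phi /\ exists2 g, retr S g = 1 & phi (v j) = g * v j * g^-1.

(** [phi] sends the generators outside [S] to conjugates of themselves, hence into the kernel, so
    [retr S \o phi] factors through [retr S]. *)
Lemma retr_Aut0 S phi x : Aut0 e phi -> retr S x = 1 -> retr S (phi x) = 1.
Proof.
move=> A x1; have phiM := @automM _ phi; have rM := @retrM _ e S.
suff -> : retr S (phi x) = retr S (phi (retr S x)) by rewrite x1 (morph1 phiM) retr1.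
move: x {x1}; apply: presented_morph_eq => [x y|x y|i]; rewrite ?phiM ?rM ?phiM ?rM //.
rewrite retr_gen; case: ifP => // iS; have [g ->] := A i.
by rewrite (morph1 phiM) retr1 !rM retrV retr_gen iS mulg1 mulgV.
Qed.

Lemma conj_trivially_subgroup S j : is_subgroup [set phi | conj_trivially S j phi]%classic.
Proof.
have [A1 AV] := Aut0_subgroup e.
split; rewrite ?inE.
  by split; [rewrite inE in A1|exists 1; rewrite ?retr1 // mul1g invg1 mulg1].
move=> f h; rewrite !inE => -[fA [x x1 fx]] [hA [y y1 hy]].
have A : Aut0 e (f * h^-1) by have := AV f h; rewrite !inE; apply.
have hVA : Aut0 e h^-1.
  by have := AV 1 h; rewrite !inE mul1g; apply; rewrite // inE in A1.
have hM := @automM _ h; have hVM := @automM _ h^-1; have fM := @automM _ f.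
split=> //; exists (f (h^-1 y)^-1 * x).
  rewrite retrM x1 mulg1; apply: retr_Aut0 => //.
  by rewrite retrV retr_Aut0 // invg1.
rewrite -[LHS]/(f (h^-1 (v j))).
have -> : h^-1 (v j) = (h^-1 y)^-1 * v j * h^-1 y.
  apply: (can_inj (automorphismVK h)).
  rewrite automorphismKV !hM (morphV hM) !automorphismKV hy.
  by rewrite !mulgA mulVg mul1g mulgVK.
by rewrite !fM fx !invgM !(morphV fM) invgK !mulgA.
Qed.

Lemma Out0_conj_trivially S j phi :
  (forall i k K, is_min_outside_star e i k -> is_component e i K -> k \notin K ->
     j \in K -> i \notin S) ->
  Out0 e phi -> conj_trivially S j phi.
Proof.
move=> H; apply: (smallest_sub (@conj_trivially_subgroup S j)) => chi0.
move=> [i [k [K [mk cK kK chiE0]]]]; split.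
  move=> l; rewrite chiE0; case: ifP => _; first by exists (v i).
  by exists 1; rewrite mul1g invg1 mulg1.
rewrite chiE0; case: ifP => jK; last by exists 1; rewrite ?retr1 // mul1g invg1 mulg1.
by exists (v i) => //; rewrite retr_gen (negPf (H _ _ _ mk cK kK jK)).
Qed.

Lemma component_outside i K j : is_component e i K -> j \in K -> j \notin star e i.
Proof.
move=> [x xi ->]; rewrite inE => /connectP[p + ->].
by elim: p x xi => //= y p IH x xi /andP[/and3P[_ yi _]]; exact: IH.
Qed.

Lemma special_commute S x i : (forall j, j \in S -> commute (v i) (v j)) ->
  special S x -> commute (v i) x.
Proof.
move=> H; apply: special_ind => [|a b {}x aS IH]; first exact: commute1.
by apply: commuteM => //; case: b => /=; [apply: commuteV|]; exact: H.
Qed.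

(** When the generators in [S] commute, an element is the product of its [a]-part and the rest. *)
Lemma special_setD1 S a x : a \in S -> (forall i j, i \in S -> j \in S -> commute (v i) (v j)) ->
  special S x -> retr [set a]%SET x = 1 -> special (S :\ a) x.
Proof.
move=> aS SC sx x1; suff E : x = retr [set a]%SET x * retr (S :\ a) x.
  by rewrite /special [RHS]E x1 mul1g.
move: x sx {x1}; apply: special_ind => [|c b x cS IH]; first by rewrite !retr1 mulg1.
rewrite {1}IH !retrM !retr_vpow !inE cS andbT.
case: eqP => [->|ca] /=; first by rewrite mul1g mulgA.
rewrite mul1g !mulgA; congr (_ * _); apply/commute_sym.
have cc j : j \in [set a]%SET -> commute (v c) (v j) by rewrite inE => /eqP->; exact: SC.
have := special_commute cc (special_retr [set a]%SET x).
by case: (b) => //= C; apply: commuteV; apply: commute_sym.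
Qed.

(* With [t] the second vertex, [Out0] fixes [v_o], and fixes [v_t] after killing
   the vertices outside [star o] and [t]; hence [x] is supported on the clique
   [star o :&: star t], and the vertices [j_a] show that its exponents vanish. *)
Lemma inner_Out0 (o : 'I_N) x phi :
  is_tree e -> o = 0 :> nat -> Out0 e phi -> (forall y, phi y = x * y * x^-1) -> phi = 1.
Proof.
move=> [_ acyclic] o0 Ophi phix.
have fixS S j : (forall i k K, is_min_outside_star e i k -> is_component e i K ->
     k \notin K -> j \in K -> i \notin S) ->
    exists2 g, retr S g = 1 & special (star e j) (g^-1 * x).
  move=> /Out0_conj_trivially/(_ Ophi)[_ [g g1 gE]]; exists g => //.
  apply: (centralizer_gen e_sym e_irr).
  apply: (@mulgI _ g); apply: (@mulIg _ x^-1).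
  by rewrite !mulgA mulgK mulgV mul1g -phix gE.
(* [v j] is never conjugated by [v a] in a generator from [P0], and [a] is outside the star of [j];
   so the exponent of [v a] in [x] vanishes. *)
have fixa a j : first_outside a = Some j -> retr [set a]%SET x = 1.
  move=> ja; have [|g g1 sp] := fixS [set a]%SET j.
    move=> i k K mk cK kK jK; apply/negP; rewrite inE => /eqP ia; subst i.
    by move: kK; move/first_outsideP: mk; rewrite ja => -[<-]; rewrite jK.
  have [ja' _] := (first_outsideP a j).2 ja.
  rewrite -[x](mulVKg g) retrM g1 mul1g -sp retrI.
  have -> : [set a]%SET :&: star e j = finset.set0.
    apply/finset.setP => k; rewrite !inE; apply/negP => /andP[/eqP-> h].
    by move: ja'; rewrite (star_sym e_sym) inE h.
  elim/raag_ind_l: (_ * _) => [|c b h IH]; first exact: retr1.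
  by rewrite retrM IH retr_vpow inE mulg1.
(* Vertices whose star is not everything are removed from [S] one by one by [fixa]; what remains is
   central. *)
have central_ok S : (forall i j, i \in S -> j \in S -> commute (v i) (v j)) ->
    special S x -> phi = 1.
  elim: {S}#|S|.+1 {-2}S (ltnSn #|S|) => // n IH S sS SC sx.
  have [/existsP[a /andP[aS na]]|] := boolP [exists a in S, first_outside a != None].
    case E: (first_outside a) na => [j|] // _.
    apply: (IH (S :\ a)).
    - by move: sS; rewrite (finset.cardsD1 a) aS; lia.
    - by move=> i k; rewrite !inE => /andP[_ iS] /andP[_ kS]; exact: SC.
    - by apply: special_setD1 => //; exact: fixa E.
  rewrite negb_exists => /forallP cen; apply: raag_automorphismP => i.
  rewrite phix; suff C : commute (v i) x by rewrite -C mulgK.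
  apply: special_commute sx => j jS; apply: gen_commute.
  rewrite (star_sym e_sym); apply/negPn/negP => ij.
  have := cen j; rewrite jS /= negbK => /eqP E.
  by have := @first_outside_visible j (Some i) ij; rewrite E.
(* [o] has the least index, so whenever it is outside a star it is the vertex that must not move. *)
have so : special (star e o) x.
  have [|g] := fixS [set: 'I_N]%SET o; last by rewrite retrT => ->; rewrite invg1 mul1g.
  move=> i k K [ki mk] cK kK oK; have oi := component_outside cK oK.
  have ko : k = o by apply/val_inj/eqP; rewrite /= o0 -leqn0 -[X in _ <= X]o0 mk.
  by move: kK; rewrite ko oK.
have [/existsP[t' ot']|] := boolP [exists t, t != o]; last first.
  rewrite negb_exists => /forallP N1; apply: (central_ok (star e o)) => // i j _ _.
  by have := N1 i; have := N1 j; rewrite !negbK => /eqP-> /eqP->; exact: commute_refl.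
have [t to mt] : exists2 t, t != o & forall k, k != o -> t <= k.
  by have [t to mt] := @arg_minnP _ t' (fun t => t != o) val ot'; exists t.
pose S := (star e o :|: [set t])%SET.
(* A vertex [i] of [S] with [t] outside its star lies in the star of [o]; then [t] is the least
   vertex outside the star of [i] and must not move. *)
have st : special (star e t) x.
  have [|g g1 sp] := fixS S t.
    move=> i k K [ki mk] cK kK tK; apply/negP => iS; have ti := component_outside cK tK.
    have io : i \in star e o.
      move: iS; rewrite finset.in_setU finset.in_set1 => /orP[io|/eqP it] //.
      by move: ti; rewrite it star_refl.
    have ko : k != o by apply: contraNneq ki => ->; rewrite (star_sym e_sym).
    have kt : k = t by apply: val_inj; apply/eqP; rewrite /= eqn_leq mk ?mt.
    by move: kK; rewrite kt tK.
  have sS : special S x by apply: special_sub so; exact: finset.subsetUl.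
  rewrite -sS -[x](mulVKg g) retrM g1 mul1g -sp retrI.
  by apply: special_sub (special_retr _ _); exact: finset.subsetIr.
apply: (central_ok (star e o :&: star e t)); last by rewrite /special -retrI st so.
move=> i j; rewrite !finset.in_setI => /andP[io it] /andP[jo jt].
have [->|ij] := eqVneq i j; first exact: commute_refl.
apply: gen_commute; apply/negPn/negP => nij.
have nij' : i \notin star e j by rewrite (star_sym e_sym).
have adj p q r : r \notin star e q -> q \in star e p -> r \in star e p -> e p q.
  move=> rq qp rp; move: qp rq; rewrite inE => /orP[/eqP->|//].
  by rewrite rp.
(* Two non-adjacent vertices in both stars would close a cycle of length four with [o] and [t]. *)
apply: (acyclic [:: o; i; t; j]) => //.
have [oi ti] := (adj _ _ _ nij io jo, adj _ _ _ nij it jt).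
have [oj tj] := (adj _ _ _ nij' jo io, adj _ _ _ nij' jt it).
have neq p q : e p q -> p != q by apply: contraTneq => ->; rewrite e_irr.
rewrite /ucycle /= oi (e_sym i) ti tj (e_sym j) oj /= !inE !negb_or.
by rewrite (neq _ _ oi) (neq _ _ oj) eq_sym to ij (eq_sym i t) (neq _ _ ti) (neq _ _ tj).
Qed.

End Out0.

(** * Trees *)

Section Tree.
Variables (N : nat) (e : rel 'I_N).
Hypotheses (e_sym : symmetric e) (e_irr : irreflexive e) (e_tree : is_tree e).
Local Notation W := (raag e).
Local Notation lam := (@lam N e).
Implicit Types (a c : 'I_N) (phi : automorphism W) (g : option 'I_N -> W).

Lemma edge_stars a b c : e a b -> c \in star e a -> c \in star e b -> c = a \/ c = b.
Proof.
rewrite !inE => eab /orP[/eqP|eac]; first by left.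
move=> /orP[/eqP|ebc]; first by right.
have neq p q : e p q -> p != q by apply: contraTneq => ->; rewrite e_irr.
case: (e_tree.2 [:: a; b; c]) => //.
rewrite /ucycle /= eab ebc e_sym eac /= !inE negb_or.
by rewrite (neq _ _ eab) (neq _ _ eac) (neq _ _ ebc).
Qed.

(* Two adjacent vertices suffice: in a tree every other vertex is outside the
   star of one of them. *)
Lemma common_level phi g (k : 'I_N -> int) (o : 'I_N) : conjugators phi g ->
  (forall a c, c \notin star e a -> level g a (g (Some c)) = k a) ->
  exists h, forall a, level g a h = k a.
Proof.
move=> gE gk; have phiM := @automM _ phi.
have notin_star a c : a \notin star e c -> c \notin star e a.
  by rewrite (star_sym e_sym).
have [/existsP[b ob]|] := boolP [exists b, e o b]; last first.
  (* Every other vertex is outside the star of [o], so only the level at [o] has to be adjusted. *)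
  rewrite negb_exists => /forallP isol.
  have [y sy ly] := lam_reach e_sym e_irr o (k o).
  have {}sy : special (star e o) y.
    by apply: special_sub sy; rewrite finset.sub1set star_refl.
  exists (g (Some o) * y) => a; have [->|ao] := eqVneq a o.
    by rewrite /level mulKg.
  have oa : a \notin star e o by rewrite inE (negPf ao) (negPf (isol a)).
  by rewrite (level_special e_sym e_irr _ _ oa sy) gk // notin_star.
have [l sl sx] := adj_meet e_sym e_irr phiM gE ob.
move: sx; set x := _^-1 * _ => sx.
(* The point [g (Some o) * l] lies in both star cosets. Powers [y] of [v o] and [z] of [v b] keep it
   there; their exponents are the target levels minus what [l] and [x^-1 * y] contribute. *)
have [y sy ly] := lam_reach e_sym e_irr o (k o - lam o l)%R.
have [z sz lz] := lam_reach e_sym e_irr b (k b - lam b (x^-1 * y))%R.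
have bo : b \in star e o := adj_star ob.
have ob' : o \in star e b by rewrite (star_sym e_sym).
have sub1 i j : j \in star e i -> [set j]%SET \subset star e i by rewrite finset.sub1set.
exists (g (Some o) * (l * (y * z))) => a.
have so : special (star e o) (l * (y * z)).
  apply: specialM => //; apply: specialM.
    exact: special_sub (sub1 _ _ (star_refl e o)) sy.
  exact: special_sub (sub1 _ _ bo) sz.
have hE : g (Some o) * (l * (y * z)) = g (Some b) * (x^-1 * (y * z)).
  by rewrite /x !invgM !invgK !mulgA mulgV mul1g.
have sb : special (star e b) (x^-1 * (y * z)).
  apply: specialM; first exact: specialV.
  apply: specialM; first exact: special_sub (sub1 _ _ ob') sy.
  exact: special_sub (sub1 _ _ (star_refl e b)) sz.
have [ao|ao] := boolP (a \in star e o); last first.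
  by rewrite (level_special e_sym e_irr _ _ ao so) gk // notin_star.
have [ab|ab] := boolP (a \in star e b); last first.
  by rewrite hE (level_special e_sym e_irr _ _ ab sb) gk // notin_star.
case: (edge_stars ob ao ab) => ->.
  rewrite /level mulKg (lam_star_l e_sym e_irr) //.
  rewrite (lam_special_r e_sym e_irr _ _ sz) ?ly ?inE; first by lia.
  by apply: contraTneq ob => ->; rewrite e_irr.
rewrite hE /level mulKg mulgA (lam_star_l e_sym e_irr) ?lz; first by rewrite GRing.addrC GRing.subrK.
apply: specialM; first exact: specialV.
exact: special_sub (sub1 _ _ ob') sy.
Qed.

Lemma Out0_normal_forms (o : 'I_N) : o = 0 :> nat -> has_regular_normal_forms (Out0 e).
Proof.
move=> o0; apply: (@normal_forms_of_settled _ _ e_sym e_irr false (first_outside e)) => //.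
- exact: first_outside_visible.
- exact: generated_subgroup.
- move=> phi Ophi; have [|] := @Out0_conj_trivially _ e finset.set0 o phi _ Ophi => //.
  by move=> *; rewrite inE.
- by move=> a B /and3P[cB _ jB]; exact: chi_Out0.
move=> phi g Ophi gE settled.
pose k a := lev g a (first_outside e a).
have gk a c : c \notin star e a -> level g a (g (Some c)) = k a.
  by move=> ca; exact: (settled a (Some c)).
(* With a point at all the common levels, [level_inner] makes [phi] inner, and [inner_Out0] makes it
   trivial. *)
have [h hk] := common_level o gE gk.
apply: (inner_Out0 e_sym e_irr e_tree o0 Ophi (x := h)).
apply: (level_inner e_sym e_irr (@automM _ phi) gE _ hk gk) => y.
by exists (phi^-1 y); exact: automorphismKV.
Qed.

End Tree.

Theorem corollary8p13 (N : nat) (e : rel 'I_N) (N_gt0 : (0 < N)%N)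
    (e_sym : symmetric e) (e_irr : irreflexive e) (e_tree : is_tree e) :
  has_regular_normal_forms (Out0 e) /\ has_regular_normal_forms (Aut0 e).
Proof.
split; last exact: Aut0_normal_forms.
exact: (@Out0_normal_forms _ _ e_sym e_irr e_tree (Ordinal N_gt0)).
Qed.
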